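(* The map $H_x(\tilde t)$ of a canonical deformation, and hence the canonical group $T_X^{gH}$, is uniquely determined by the deformation coefficients $h_x$ and the connection $\Gamma_x$. That is, if $H$ and $H'$ are two canonical deformations with $h_x=h'_x$ and $\Gamma_x=\Gamma'_x$ for all $x\in X$, then $H_x(\tilde t)=H'_x(\tilde t)$ for all $x\in X$ and all (sufficiently small) $\tilde t\in\widetilde T$, and the groups $T_X^{gH}$ and $T_X^{gH'}$ coincide.
   Context: All considerations are local: points are taken sufficiently close, so that any two of them are joined by a unique (short) geodesic, and parameters are small. $X$ is an open coordinate domain, regarded as a domain of a finite-dimensional real affine space with translation vector space $\widetilde T$; $T$ is a real vector space isomorphic to $\widetilde T$. A deformation is a family of maps $H_x:\widetilde T\to T$, $x\in X$, smooth in all variables, each a (local, near $0$) diffeomorphism with $H_x(0)=0$; $K_x:=H_x^{-1}$. The deformation coefficients are $h_x:=DH_x(0)$ (equivalently $k_x:=h_x^{-1}=DK_x(0)$). The deformed gauge group of translations $T_X^{gH}$ is the (local) group of smooth functions $x\mapsto t_x\in T$ for which $x\mapsto x+K_x(t_x)$ has invertible derivative, with multiplication $(t\times t')_x=\varphi_x(t_x,t'_{x'})$, where $\varphi_x(t,t'):=H_x(K_x(t)+K_{x'}(t'))$, $x'=x+K_x(t)$, and action $x\mapsto x+K_x(t_x)$ on $X$. The group defines on $X$ the torsion-free affine connection with coefficients $\Gamma_x:=k_x\circ D^2H_x(0)$ in the holonomic frame. The group (and the deformation $H$) is called canonical if for any two points $x,x'\in X$ there is a smooth parametric curve $x(s)$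 through them, starting at $x(0)=x$, such that, with $\tau_{x(s)}:=h_{x(s)}\langle\dot x(s)\rangle$ and $x'=x(s)$, one has $\varphi_x(s\tau_x,s'\tau_{x'})=(s+s')\tau_x$ for all (admissible) $s,s'$. *)

(* Defs.v *)
(* MathComp-Analysis. *)
From HB Require Import structures.
From mathcomp Require Export all_boot all_order all_algebra.
From mathcomp Require Export all_classical all_reals all_analysis.

Set Implicit Arguments.
Unset Strict Implicit.
Unset Printing Implicit Defensive.

Import Order.TTheory GRing.Theory Num.Theory.
Import numFieldNormedType.Exports.

Local Open Scope classical_set_scope.
Local Open Scope ring_scope.

(* [A] is meant to be open and [U] finite-dimensional; then C^k in the sense of
   iterated directional derivatives is C^k in the usual sense. *)
Fixpoint Ck {R : realType} {U V : normedModType R} (k : nat) (A : set U)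
    (f : U -> V) : Prop :=
  match k with
  | 0 => forall x, A x -> {for x, continuous f}
  | k'.+1 => (forall x, A x -> differentiable f x) /\
             forall v, Ck k' A ('D_v f)
  end.

Definition smooth {R : realType} {U V : normedModType R} (A : set U)
  (f : U -> V) : Prop := forall k, Ck k A f.

Definition D2 {R : realType} {U V : normedModType R} (f : U -> V) (a u v : U) :
  V := 'D_u ('D_v f) a.

(* The affine space is read in affine coordinates: both its points and its
   translations are row vectors, and [X] is an open set of points. The maps
   [H_x] are only defined near [0]: [ddom] is the open set of pairs [(x, v)]
   for which [H_x v] is defined; the values of [dmap] elsewhere are irrelevant.
   The space [T] carries a norm only to name its (unique) vector topology. *)
Section Deformation.
Context {R : realType} {n : nat} {T : normedModType R}.
Local Notation V := ('rV[R]_n).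

Record deformation (X : set V) := Deformation {
  ddom : set (V * V);
  dmap :> V -> V -> T;
  ddom_open : open ddom;
  ddom_sub : forall x v, ddom (x, v) -> X x;
  ddom0 : forall x, X x -> ddom (x, 0);
  dmap_smooth : smooth ddom (fun p : V * V => dmap p.1 p.2);
  dmap_inj : forall x, X x -> {in xsection ddom x &, injective (dmap x)};
  dimg_open : forall x, X x -> open (dmap x @` xsection ddom x);
  dinv_smooth : forall x, X x ->
    smooth (dmap x @` xsection ddom x)
           ('pinv_(fun=> 0) (xsection ddom x) (dmap x));
  dmap0 : forall x, X x -> dmap x 0 = 0
}.

Variable X : set V.
Implicit Types (D : deformation X) (x u v : V) (t : T).

(* K_x = H_x^{-1}, with [dimg D x] its domain of definition. *)
Definition dimg D x : set T := D x @` xsection (ddom D) x.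
Definition dinv D x : T -> V := 'pinv_(fun=> 0) (xsection (ddom D) x) (D x).

Definition coef_h D x : V -> T := 'd (D x) (0 : V).
Definition coef_k D x : T -> V := 'd (dinv D x) (0 : T).

Definition connection D x u v : V := coef_k D x (D2 (D x) 0 u v).

Definition phi D x t t' : T :=
  D x (dinv D x t + dinv D (x + dinv D x t) t').

Definition phi_defined D x t t' : Prop :=
  [/\ dimg D x t, dimg D (x + dinv D x t) t' &
      ddom D (x, dinv D x t + dinv D (x + dinv D x t) t')].

(* [c], smooth on a neighbourhood [I] of [0, S], runs in [X] from [x] to [x'];
   [s, s'] are admissible when [s] and [s + s'] are parameters of points of the
   curve and the product is defined. Requiring that [s tau_x] lie in the domain
   of [K_x] for all parameters [s] keeps the condition from being vacuous. *)
Definition canonical_curve D x x' (S : R) (I : set R) (c : R -> V) : Prop :=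
  let tau s := coef_h D (c s) (derive1 c s) in
  [/\ [/\ 0 <= S, open I, `[0, S] `<=` I & smooth I c],
      [/\ c 0 = x, c S = x' & forall s, s \in `[0, S] -> X (c s)],
      (forall s, s \in `[0, S] -> dimg D x (s *: tau 0)) &
      forall s s', s \in `[0, S] -> s + s' \in `[0, S] ->
        phi_defined D x (s *: tau 0) (s' *: tau s) ->
        phi D x (s *: tau 0) (s' *: tau s) = (s + s') *: tau 0].

(* Any two sufficiently close points of [X] are joined by a canonical curve;
   closeness is locally uniform. *)
Definition canonical D : Prop :=
  forall x0, X x0 -> \forall p \near (x0, x0),
    exists S I c, canonical_curve D p.1 p.2 S I c.

Definition gauge_act D (t : V -> T) x : V := x + dinv D x (t x).

Definition gauge_mul D (t t' : V -> T) x : T :=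
  phi D x (t x) (t' (gauge_act D t x)).

Definition gauge_mul_defined D (t t' : V -> T) : Prop :=
  forall x, X x -> phi_defined D x (t x) (t' (gauge_act D t x)).

Definition gauge_elt D (t : V -> T) : Prop :=
  smooth X t /\
  forall x, X x ->
    [/\ dimg D x (t x), differentiable (gauge_act D t) x &
        bijective ('d (gauge_act D t) x : V -> V)].

(* Equality of local groups: the two groups have the same elements, the same
   action on [X] and the same (everywhere defined) products on all functions
   with graph in some neighbourhood [W] of the zero section. *)
Definition gauge_groups_coincide D D' : Prop :=
  exists W : set (V * T),
  [/\ open W, (forall x, X x -> W (x, 0)) &
   let small (t : V -> T) := forall x, X x -> W (x, t x) in
   [/\ forall t : V -> T, small t -> (gauge_elt D t <-> gauge_elt D' t),
       forall t : V -> T, small t -> gauge_elt D t ->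
         {in X, gauge_act D t =1 gauge_act D' t} &
       forall t t' : V -> T, small t -> small t' ->
         gauge_elt D t -> gauge_elt D t' ->
         [/\ gauge_mul_defined D t t', gauge_mul_defined D' t t' &
             {in X, gauge_mul D t t' =1 gauge_mul D' t t'}]]].

End Deformation.
Arguments deformation {R n} T X.

(* Main.v *)
Require Import Defs.
From mathcomp Require Import ring lra.
Set Implicit Arguments.
Unset Strict Implicit.
Unset Printing Implicit Defensive.
Import Order.TTheory GRing.Theory Num.Theory.
Import numFieldNormedType.Exports.
Local Open Scope classical_set_scope.
Local Open Scope ring_scope.

(* Fix x0 in X and read the values of H_x in the chart k0 = h_{x0}^{-1}. A
   canonical curve c from x to x' is the orbit c(s) = x + K_x(s tau_0), and
   canonicity says that H_{c(s)}(c(t) - c(s)) = (t - s) tau_s for t near s.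
   Differentiating twice at t = s gives h_c(c'') + D^2 H_c(0)(c', c') = 0, so
   that c is a geodesic of Gamma, while t = S, s = 0 gives
   H_x(x' - x) = S h_x(c'(0)). If x and x' are close to x0, then c stays close
   to x0 and, rescaled to the time interval [0, 1], it is slow. Slow geodesics
   with the same end points coincide, because halving any bound on the
   difference of the accelerations gives a new bound. Since h and Gamma are the
   same for H and H', it follows that H_x(x' - x) = H'_x(x' - x). *)

(** * Calculus with row vectors *)

Section RowVectors.
Context {R : realType}.

(** Canonicity speaks of the orbit x + K_x(s tau_0) with velocities tau_s taken from the curve [c],
    and only of products that are defined. That the orbit stays in [X], and that it is [c], both
    have to be proved: wherever they meet, both solve the same first order equation h_z(z') = tau_s,
    and a continuation along [0, S] identifies them.

    The definition puts no bound on the length S or on the excursions of [c], and the S of [H] is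
    unrelated to that of [H']. Control comes from H_x itself: read through the linear chart, it
    distorts small displacements by a factor between 1/2 and 3/2.

    Uniqueness is that of a two-point problem, because the initial velocity is exactly what has to
    be compared. Without a bound on the speed two geodesics may meet again, whence the restriction
    to close points.

    For the groups, agreement near the zero section of displacements has to become agreement of
    inverses and products near the zero section of [T]. This takes preimages under H_x that are
    small uniformly in x. *)

Lemma rV_norm_le {n} (v : 'rV[R]_n) (M : R) :
  0 <= M -> (forall j, `|v 0 j| <= M) -> `|v| <= M.
Proof.
move=> M0 vM; rewrite /Num.Def.normr/= mx_normrE (bigmax_le _ M0)//=.
by move=> -[i j] _; rewrite ord1.
Qed.

Lemma rV_coord_le {n} (v : 'rV[R]_n) j : `|v 0 j| <= `|v|.
Proof.
by rewrite [leRHS]/Num.Def.normr/= mx_normrE; exact: (le_bigmax _ _ (0, j)).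
Qed.

Lemma norm_segment_lt {W : normedModType R} (u v : W) (r s : R) :
  s \in `[0, 1] -> `|u| < r -> `|v| < r -> `|s *: u + (1 - s) *: v| < r.
Proof.
rewrite in_itv/= => /andP[s0 s1] ur vr.
apply: (le_lt_trans (ler_normD _ _)); rewrite !normrZ !ger0_norm ?subr_ge0//.
move: s0; rewrite le_eqVlt => /predU1P[<-|s0].
  by rewrite mul0r add0r subr0 mul1r.
apply: (@lt_le_trans _ _ (s * r + (1 - s) * r)); last by lra.
apply: ltr_leD; first by rewrite ltr_pM2l.
by rewrite ler_wpM2l ?subr_ge0// ltW.
Qed.

Lemma norm_lincomb_le {n} {W : normedModType R} (v : 'rV[R]_n)
    (f : 'I_n -> W) (M : 'I_n -> R) :
  (forall j, `|f j| <= M j) ->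
  `|\sum_j v 0 j *: f j| <= `|v| * \sum_j M j.
Proof.
move=> fM; apply: (le_trans (ler_norm_sum _ _ _)).
rewrite mulr_sumr; apply: ler_sum => j _; rewrite normrZ.
by apply: ler_pM => //; exact: rV_coord_le.
Qed.

Lemma is_derive_coord {n} (c : R -> 'rV[R]_n) (s : R) dc j :
  is_derive s 1 c dc -> is_derive s 1 (fun s => c s 0 j) (dc 0 j).
Proof.
move=> [dcs <-]; split; first by move/derivable_mxP: dcs; exact.
by rewrite derive_mx// mxE.
Qed.

Lemma is_derive_comp_curve {U W : normedModType R} (z : R -> U) dz
    (f : U -> W) (s : R) :
  is_derive s 1 z dz -> differentiable f (z s) ->
  is_derive s 1 (fun s => f (z s)) ('D_dz f (z s)).
Proof.
move=> [dzs <-] df.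
have dzs' : differentiable z s by exact/derivable1_diffP.
have dfz : differentiable (f \o z) s by exact: differentiable_comp.
split; first exact/derivable1_diffP.
by rewrite -[LHS]/('D_1 (f \o z) s) deriveE// diff_comp//= !deriveE.
Qed.

Lemma is_derive_pairr {U W : normedModType R} (y : U) (z : R -> W) dz (s : R) :
  is_derive s 1 z dz -> is_derive s 1 (fun s => (y, z s)) (0, dz).
Proof.
move=> [dzs <-].
have dzs' : differentiable z s by exact/derivable1_diffP.
have dp : differentiable (fun s => (y, z s)) s.
  exact: (differentiable_pair (differentiable_cst _ _) dzs').
split; first exact/derivable1_diffP.
rewrite deriveE// (diff_pair (differentiable_cst y s) dzs')/=.
by rewrite diff_cst deriveE.
Qed.

(** The intermediate point of the scalar theorem depends on the coordinate, so only an inequality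
    survives; with the sup norm it is checked one coordinate at a time, without loss. *)
Lemma MVT_rV {n} (f f' : R -> 'rV[R]_n) (a b M : R) : a <= b -> 0 <= M ->
  (forall s : R, s \in `[a, b] -> is_derive s 1 f (f' s)) ->
  (forall s : R, s \in `]a, b[ -> `|f' s| <= M) ->
  `|f b - f a| <= M * (b - a).
Proof.
move=> ab M0 df f'M; apply: rV_norm_le => [|j].
  by rewrite mulr_ge0// subr_ge0.
move: ab; rewrite le_eqVlt => /predU1P[<-|ab].
  by rewrite !subrr mxE normr0 mulr0.
have dfj s : s \in `[a, b] -> is_derive s 1 (fun s => f s 0 j) (f' s 0 j).
  by move=> sab; apply: is_derive_coord; exact: df.
have dfoo s : s \in `]a, b[ -> is_derive s 1 (fun s => f s 0 j) (f' s 0 j).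
  by move=> sab; apply: dfj; exact: subset_itv_oo_cc.
have fc : {within `[a, b], continuous (fun s => f s 0 j)}.
  by apply: derivable_within_continuous => s /dfj[].
have [s sab] := MVT ab dfoo fc.
have ba : 0 <= b - a by rewrite subr_ge0 ltW.
rewrite !mxE => ->; rewrite normrM (ger0_norm ba) ler_wpM2r//.
by apply: le_trans (f'M _ sab); exact: rV_coord_le.
Qed.

Lemma MVT_rV_itv {n} (f f' : R -> 'rV[R]_n) (a b M : R) : 0 <= M ->
  (forall s : R, s \in `[a, b] -> is_derive s 1 f (f' s)) ->
  (forall s : R, s \in `]a, b[ -> `|f' s| <= M) ->
  forall s t : R, s \in `[a, b] -> t \in `[a, b] ->
  `|f t - f s| <= M * `|t - s|.
Proof.
move=> M0 df f'M s t.
wlog st : s t / s <= t => [W sab tab|].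
  have [st|/ltW ts] := leP s t; first exact: W.
  by rewrite distrC (distrC t); exact: W.
rewrite !in_itv/= => /andP[as_ sb] /andP[at_ tb].
rewrite (@ger0_norm _ (t - s)) ?subr_ge0//.
have df_st (r : R) : r \in `[s, t] -> is_derive r 1 f (f' r).
  rewrite in_itv/= => /andP[sr rt].
  by apply: df; rewrite in_itv/= (le_trans as_)//= (le_trans rt).
have f'M_st (r : R) : r \in `]s, t[ -> `|f' r| <= M.
  rewrite in_itv/= => /andP[sr rt].
  by apply: f'M; rewrite in_itv/= (le_lt_trans as_)//= (lt_le_trans rt).
exact: MVT_rV st M0 df_st f'M_st.
Qed.

(** The supremum of [g] is at most half of itself. The a priori bound [M0] makes it finite; this
    takes the place of iterating an estimate. *)
Lemma le0_of_halving {I : Type} (A : set I) (g : I -> R) (M0 : R) :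
  (forall t, A t -> g t <= M0) ->
  (forall M, (forall t, A t -> g t <= M) -> forall t, A t -> g t <= M / 2) ->
  forall t, A t -> g t <= 0.
Proof.
move=> gM0 gh t At.
have hs : has_sup (g @` A).
  split; first by exists (g t), t.
  by exists M0 => _ [u Au <-]; exact: gM0.
have gsup u : A u -> g u <= sup (g @` A).
  by move=> Au; apply: sup_upper_bound => //; exists u.
have : sup (g @` A) <= sup (g @` A) / 2.
  by apply: ge_sup; [exact: hs.1|move=> _ [u Au <-]; exact: gh gsup _ Au].
have := gsup _ At; lra.
Qed.

(** Continuation principle: the supremum of the times up to which [P] holds has the property by
    closedness on the left, and openness on the right forbids that it be less than [S]. *)
Lemma real_induction (P : R -> Prop) (S : R) : 0 <= S -> P 0 ->
  (forall s, 0 <= s < S -> P s ->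
     \forall r \near s, s <= r -> r \in `[0, S] -> P r) ->
  (forall s, 0 < s <= S -> (forall r, 0 <= r < s -> P r) -> P s) ->
  forall s : R, s \in `[0, S] -> P s.
Proof.
move=> S0 P0 Pright Pleft.
pose A := [set s | 0 <= s <= S /\ forall r, 0 <= r <= s -> P r].
have A0 : A 0.
  split; first by rewrite lexx.
  by move=> r r0; rewrite (_ : r = 0)//; apply/le_anti; rewrite andbC.
have hs : has_sup A by split; [exists 0|exists S => s [/andP[]]].
set m := sup A.
have m0 : 0 <= m by exact: (sup_upper_bound hs).
have mS : m <= S by apply: ge_sup; [exact: hs.1|move=> s [/andP[]]].
have Plt r : 0 <= r < m -> P r.
  move=> /andP[r0 rm]; have [s [_ sP] rs] := sup_gt hs.1 rm.
  by apply: sP; rewrite r0 ltW.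
have Pm : P m.
  move: m0; rewrite le_eqVlt => /predU1P[<-//|m0].
  by apply: Pleft => //; rewrite m0.
have Ple r : 0 <= r <= m -> P r.
  rewrite [r <= m]le_eqVlt => /andP[r0 /predU1P[->//|rm]].
  by apply: Plt; rewrite r0.
have mES : m = S.
  apply/eqP; rewrite eq_le mS/= leNgt; apply/negP => mltS.
  have /nbhs_ballP[e /= e0 eP] := Pright _ (introT andP (conj m0 mltS)) Pm.
  pose d := Num.min (e / 2) (S - m).
  have d0 : 0 < d by rewrite lt_min divr_gt0//= subr_gt0.
  have de : d <= e / 2 by rewrite ge_min lexx.
  have dS : d <= S - m by rewrite ge_min lexx orbT.
  suff /(sup_upper_bound hs) : A (m + d) by rewrite -/m; lra.
  split=> [|r /andP[r0 rmd]]; first by apply/andP; split; lra.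
  have [rm|mr] := leP r m; first by apply: Ple; rewrite r0.
  apply: eP; [|exact: ltW|by rewrite in_itv/=; apply/andP; split; lra].
  by rewrite /ball/= ltr0_norm; lra.
by move=> s; rewrite in_itv/= -mES; exact: Ple.
Qed.

Lemma derive_basis {n} {W : normedModType R} (g : 'rV[R]_n -> W) x w :
  differentiable g x ->
  'D_w g x = \sum_j w 0 j *: 'D_(delta_mx 0 j) g x.
Proof.
move=> dg; rewrite deriveE// {1}(row_sum_delta w) linear_sum.
by apply: eq_bigr => j _; rewrite linearZ deriveE.
Qed.

Lemma is_derive_line {W : normedModType R} (y d : W) (s : R) :
  is_derive s 1 (fun s => y + s *: d) d.
Proof.
have ds := is_diff_scalel s d.
have : is_derive s 1 (fun s : R => s *: d) d.
  split; first exact/derivable1_diffP/ex_diff.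
  by rewrite deriveE; [rewrite diff_val scale1r|exact: ex_diff].
by move=> /(is_deriveD (is_derive_cst y s 1)); rewrite add0r.
Qed.

(** Near [x0] each partial derivative exceeds its norm at [x0] by at most 1; the bound is integrated
    along segments, which stay in a ball by convexity. *)
Lemma C1_lipschitz {m n} (g : 'rV[R]_m -> 'rV[R]_n) x0 :
  (\forall x \near x0, differentiable g x) ->
  (forall w, {for x0, continuous ('D_w g)}) ->
  exists2 L, 0 <= L &
    \forall p \near (x0, x0), `|g p.1 - g p.2| <= L * `|p.1 - p.2|.
Proof.
move=> dg cg.
pose M j := `|'D_(delta_mx 0 j) g x0| + 1.
exists (\sum_j M j); first by apply: sumr_ge0 => j _; rewrite addr_ge0.
have Mnear j : \forall x \near x0, `|'D_(delta_mx 0 j) g x| <= M j.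
  have /cvgrPdist_le/(_ 1 ltr01) := cg (delta_mx 0 j).
  apply: filterS => x xx0; rewrite /M addrC -lerBlDr.
  by apply: le_trans xx0; rewrite distrC; exact: lerB_dist.
have : \forall x \near x0, differentiable g x /\
    forall j, `|'D_(delta_mx 0 j) g x| <= M j.
  by apply: filterI => //; exact: filter_forall Mnear.
move=> /nbhs_ballP[e /= e0 eP].
exists (ball x0 e, ball x0 e); first by split; exact: nbhsx_ballx.
move=> -[x y] /= [xe ye].
pose z s : 'rV[R]_m := y + s *: (x - y).
have ze (s : R) : s \in `[0, 1] -> ball x0 e (z s).
  move: xe ye; rewrite -!ball_normE/= => xe ye s01.
  have -> : x0 - z s = s *: (x0 - x) + (1 - s) *: (x0 - y).
    by apply/matrixP => i j; rewrite /z !mxE; ring.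
  exact: norm_segment_lt.
have M0 : 0 <= `|x - y| * \sum_j M j.
  by rewrite mulr_ge0// sumr_ge0// => j _; rewrite addr_ge0.
have dz (s : R) : s \in `[0, 1] ->
    is_derive s 1 (fun s => g (z s)) ('D_(x - y) g (z s)).
  move=> s01; apply: is_derive_comp_curve; last exact: (eP _ (ze _ s01)).1.
  exact: is_derive_line.
have Dz (s : R) : s \in `]0, 1[ ->
    `|'D_(x - y) g (z s)| <= `|x - y| * \sum_j M j.
  move=> /subset_itv_oo_cc s01; have [dgs Dg] := eP _ (ze _ s01).
  by rewrite derive_basis//; exact: norm_lincomb_le.
have := MVT_rV ler01 M0 dz Dz.
by rewrite /z scale0r scale1r addr0 (addrC y) subrK subr0 mulr1 mulrC.
Qed.

End RowVectors.

(** * Uniqueness for the geodesic equation *)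

Section ODE.
Context {R : realType} {n : nat}.
Local Notation V := 'rV[R]_n.

(** Gronwall on a short interval: since [d] vanishes at [a], a bound [M] on [d] improves to C M (b -
    a), hence to M / 2. *)
Lemma zero_of_derive_le (d d' : R -> V) (a b C M0 : R) :
  0 <= C -> C * (b - a) <= 2^-1 -> d a = 0 ->
  (forall s : R, s \in `[a, b] -> is_derive s 1 d (d' s)) ->
  (forall s : R, s \in `]a, b[ -> `|d' s| <= C * `|d s|) ->
  (forall s : R, s \in `[a, b] -> `|d s| <= M0) ->
  forall s : R, s \in `[a, b] -> d s = 0.
Proof.
move=> C0 Cab da dd d'C dM s sab; apply/eqP; rewrite -normr_le0.
move: s sab; apply: (le0_of_halving dM) => M dleM s sab.
have M0' : 0 <= M by apply: le_trans (dleM _ sab).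
have /andP[as_ sb] : a <= s <= b by rewrite in_itv/= in sab.
have sub t : t \in `[a, s] -> t \in `[a, b].
  by rewrite !in_itv/= => /andP[-> /le_trans->].
have CM : 0 <= C * M by rewrite mulr_ge0.
have := MVT_rV as_ CM (fun t ts => dd t (sub t ts)).
rewrite da subr0 => H; apply: le_trans (H _) _.
  move=> t tas; have tab : t \in `]a, b[.
    by move: tas; rewrite !in_itv/= => /andP[-> /lt_le_trans->].
  apply: le_trans (d'C _ tab) _; rewrite ler_wpM2l//; apply: dleM.
  exact: subset_itv_oo_cc.
rewrite mulrAC mulrC ler_wpM2l//; apply: le_trans Cab.
by rewrite ler_wpM2l// lerD2r.
Qed.

(** By Rolle each coordinate of [d1] vanishes somewhere, at a point depending on the coordinate.
    Integrating [d2] from there bounds [d1], and integrating [d1] from 0 bounds [d]. *)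
Lemma dirichlet_bound (d d1 d2 : R -> V) (M : R) : 0 <= M ->
  d 0 = 0 -> d 1 = 0 ->
  (forall s : R, s \in `[0, 1] -> is_derive s 1 d (d1 s)) ->
  (forall s : R, s \in `[0, 1] -> is_derive s 1 d1 (d2 s)) ->
  (forall s : R, s \in `]0, 1[ -> `|d2 s| <= M) ->
  forall s : R, s \in `[0, 1] -> `|d1 s| <= M /\ `|d s| <= M.
Proof.
move=> M0 d0 d1_0 dd dd1 d2M.
have dist1 (s t : R) : s \in `[0, 1] -> t \in `[0, 1] -> `|t - s| <= 1.
  rewrite !in_itv/= => /andP[s0 s1] /andP[t0 t1].
  by rewrite ler_norml; apply/andP; split; lra.
have H1 (s : R) : s \in `[0, 1] -> `|d1 s| <= M.
  move=> s01; apply: rV_norm_le => // j.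
  have ddj (t : R) : t \in `[0, 1] ->
      is_derive t 1 (fun s => d s 0 j) (d1 t 0 j).
    by move=> t01; apply: is_derive_coord; exact: dd.
  have ddjo (t : R) : t \in `]0, 1[ ->
      is_derive t 1 (fun s => d s 0 j) (d1 t 0 j).
    by move=> /subset_itv_oo_cc; exact: ddj.
  have dc : {within `[0, 1], continuous (fun s => d s 0 j)}.
    by apply: derivable_within_continuous => t /ddj[].
  have [t t01] := MVT ltr01 ddjo dc.
  rewrite d0 d1_0 !mxE !subr0 mulr1 => /esym dt0.
  have {}t01 := subset_itv_oo_cc t01.
  have -> : d1 s 0 j = (d1 s - d1 t) 0 j by rewrite !mxE dt0 subr0.
  apply: le_trans (rV_coord_le _ _) _.
  apply: le_trans (MVT_rV_itv M0 dd1 d2M t01 s01) _.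
  by rewrite ler_piMr// dist1.
move=> s s01; split; first exact: H1.
have z01 : (0 : R) \in `[0, 1] by rewrite in_itv/= lexx ler01.
rewrite -[d s]subr0 -d0.
have d1M (t : R) : t \in `]0, 1[ -> `|d1 t| <= M.
  by move=> /subset_itv_oo_cc; exact: H1.
apply: le_trans (MVT_rV_itv M0 dd d1M z01 s01) _.
by rewrite ler_piMr// dist1.
Qed.

(** Given by coefficient fields, so that linearity in [u] is built in and only the dependence on [x]
    has to be estimated. It will stand for h_x in a chart, and [bilin_at] for D^2 H_x(0). *)
Definition lin_at (A : 'I_n -> V -> V) x (u : V) : V :=
  \sum_j u 0 j *: A j x.

Definition bilin_at (B : 'I_n -> 'I_n -> V -> V) x (u v : V) : V :=
  \sum_i \sum_j (u 0 i * v 0 j) *: B i j x.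

Section Geodesic.
Variables (A : 'I_n -> V -> V) (B : 'I_n -> 'I_n -> V -> V) (P : set V) (L : R).
Local Notation a := (lin_at A).
Local Notation Q := (bilin_at B).

Hypotheses (L1 : 1 <= L)
  (a_id : forall x, P x -> forall u, `|a x u - u| <= 2^-1 * `|u|)
  (a_lip : forall x y, P x -> P y -> forall u,
     `|a x u - a y u| <= L * `|x - y| * `|u|)
  (Q_bound : forall x, P x -> forall u v, `|Q x u v| <= L * `|u| * `|v|)
  (Q_lip : forall x y, P x -> P y -> forall u v,
     `|Q x u v - Q y u v| <= L * `|x - y| * `|u| * `|v|).

Let aB x u v : a x (u - v) = a x u - a x v.
Proof.
by rewrite /lin_at -sumrB; apply: eq_bigr => j _; rewrite !mxE scalerBl.
Qed.

Let QBl x u v w : Q x (u - v) w = Q x u w - Q x v w.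
Proof.
rewrite /bilin_at -sumrB; apply: eq_bigr => i _; rewrite -sumrB.
by apply: eq_bigr => j _; rewrite !mxE mulrBl scalerBl.
Qed.

Let QBr x u v w : Q x w (u - v) = Q x w u - Q x w v.
Proof.
rewrite /bilin_at -sumrB; apply: eq_bigr => i _; rewrite -sumrB.
by apply: eq_bigr => j _; rewrite !mxE mulrBr scalerBl.
Qed.

Lemma le_norm_a x u : P x -> `|u| <= 2 * `|a x u|.
Proof.
move=> Px; have := a_id Px u; have := lerB_dist u (a x u).
rewrite (distrC u); lra.
Qed.

(** Subtracting the equations gives a(y)(dy - dc) = a(c) dc - a(y) dc, so |dy - dc| <= 2 L K |y -
    c|, with a speed bound on [c] alone; the factor 2 bounds the inverse of a(y). *)
Lemma ode_coincidence (y c dy dc : R -> V) (s0 s1 K M0 : R) :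
  0 <= K -> 2 * L * K * (s1 - s0) <= 2^-1 -> y s0 = c s0 ->
  (forall s : R, s \in `[s0, s1] -> is_derive s 1 y (dy s)) ->
  (forall s : R, s \in `[s0, s1] -> is_derive s 1 c (dc s)) ->
  (forall s : R, s \in `[s0, s1] ->
     [/\ P (y s), P (c s) & `|y s - c s| <= M0]) ->
  (forall s : R, s \in `]s0, s1[ -> `|dc s| <= K) ->
  (forall s : R, s \in `]s0, s1[ -> a (y s) (dy s) = a (c s) (dc s)) ->
  forall s : R, s \in `[s0, s1] -> y s = c s.
Proof.
move=> K0 K2 yc ddy ddc PM dcK aa s sI; apply/subr0_eq.
have L0 : 0 <= L by apply: le_trans L1.
apply: (@zero_of_derive_le (y - c) (dy - dc) s0 s1 (2 * L * K) M0) => //.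
- by rewrite mulr_ge0// mulr_ge0.
- by apply/eqP; rewrite subr_eq0 yc.
- by move=> t tI; have := is_deriveB (ddy t tI) (ddc t tI).
- move=> t tI; have [Py Pc _] := PM t (subset_itv_oo_cc tI).
  apply: le_trans (le_norm_a _ Py) _; rewrite aB aa//.
  rewrite -!mulrA ler_wpM2l//; apply: le_trans (a_lip Pc Py _) _.
  by rewrite distrC -mulrA ler_wpM2l// mulrC ler_wpM2r// dcK.
- by move=> t tI; have [] := PM t tI.
Qed.

(** The geodesic equation of Gamma before k_c is applied, that is h_c(c'') + D^2 H_c(0)(c', c') = 0,
    together with a bound [D] on the speed. The equation is asked on the open interval only, where
    two-sided neighbourhoods lie in the parameter interval. *)
Definition is_geodesic (D : R) (c c1 c2 : R -> V) :=
  [/\ forall s : R, s \in `[0, 1] -> is_derive s 1 c (c1 s),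
      forall s : R, s \in `[0, 1] -> is_derive s 1 c1 (c2 s) &
      forall s : R, s \in `]0, 1[ ->
        [/\ P (c s), `|c1 s| <= D &
            a (c s) (c2 s) + Q (c s) (c1 s) (c1 s) = 0]].

(** A bound [M] on c2 - e2 passes to velocities and positions by [dirichlet_bound]; the difference
    of the two equations then bounds c2 - e2 by 10 L^2 D M, which is at most M / 2. Hence the
    constant 20. *)
Lemma geodesic_unique (D : R) (c c1 c2 e e1 e2 : R -> V) :
  0 <= D <= 1 -> 20 * L ^+ 2 * D <= 1 ->
  is_geodesic D c c1 c2 -> is_geodesic D e e1 e2 ->
  c 0 = e 0 -> c 1 = e 1 -> c1 0 = e1 0.
Proof.
move=> /andP[D0 D1] D20 [dc dc1 geoc] [de de1 geoe] ce0 ce1.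
have L0 : 0 <= L by apply: le_trans L1.
have z01 : (0 : R) \in `[0, 1] by rewrite in_itv/= lexx ler01.
have geo2 (f f1 f2 : R -> V) s : [/\ P (f s), `|f1 s| <= D
    & a (f s) (f2 s) + Q (f s) (f1 s) (f1 s) = 0] ->
    `|f2 s| <= 2 * L * D ^+ 2.
  move=> [Pf f1D /eqP]; rewrite addr_eq0 => /eqP af.
  apply: le_trans (le_norm_a _ Pf) _; rewrite af normrN -mulrA ler_wpM2l//.
  apply: le_trans (Q_bound Pf _ _) _.
  by rewrite -mulrA ler_wpM2l// expr2 ler_pM.
have dd (s : R) : s \in `[0, 1] -> is_derive s 1 (c - e) (c1 s - e1 s).
  by move=> s01; apply: is_deriveB; [exact: dc|exact: de].
have dd1 (s : R) : s \in `[0, 1] ->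
    is_derive s 1 (fun s => c1 s - e1 s) (c2 s - e2 s).
  by move=> s01; have := is_deriveB (dc1 s s01) (de1 s s01).
have d0 : (c - e) 0 = 0 by apply/eqP; rewrite subr_eq0 ce0.
have d1 : (c - e) 1 = 0 by apply/eqP; rewrite subr_eq0 ce1.
have d2_0 (s : R) : s \in `]0, 1[ -> `|c2 s - e2 s| <= 0.
  pose M0 := 2 * L * D ^+ 2 + 2 * L * D ^+ 2.
  apply: (@le0_of_halving _ _ (fun s => s \in `]0, 1[)
    (fun s => `|c2 s - e2 s|) M0).
    move=> t t01; apply: (le_trans (ler_normB _ _)).
    by apply: lerD; [exact/geo2/geoc|exact/geo2/geoe].
  move=> M dM t t01.
  have M_0 : 0 <= M by apply: le_trans (dM _ t01).
  have [d1M dM0] := dirichlet_bound M_0 d0 d1 dd dd1 dM (subset_itv_oo_cc t01).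
  have [Pc c1D gc] := geoc _ t01; have [Pe e1D ge] := geoe _ t01.
  have e2D := geo2 _ _ _ _ (geoe _ t01).
  apply: le_trans (le_norm_a _ Pc) _.
  (* Difference of the two equations, with one argument changed at a time. Each of the four terms
     contains a single difference, of velocities or of base points, and so is proportional to
     [M]. *)
  have -> : a (c t) (c2 t - e2 t) =
      - (Q (c t) (c1 t - e1 t) (c1 t) + Q (c t) (e1 t) (c1 t - e1 t)
       + (Q (c t) (e1 t) (e1 t) - Q (e t) (e1 t) (e1 t)))
      - (a (c t) (e2 t) - a (e t) (e2 t)).
    move: gc ge => /eqP; rewrite addr_eq0 => /eqP gc /eqP.
    rewrite addr_eq0 => /eqP ge.
    rewrite aB QBl QBr gc ge.
    set q1 := Q _ _ _; set q2 := Q _ _ _; set q3 := Q _ _ _; set q4 := Q _ _ _.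
    set q5 := a _ _; apply/matrixP => i j; rewrite !mxE; ring.
  have T1 : `|Q (c t) (c1 t - e1 t) (c1 t)| <= L * M * D.
    apply: le_trans (Q_bound Pc _ _) _.
    by rewrite ler_pM// ?mulr_ge0// ler_wpM2l.
  have T2 : `|Q (c t) (e1 t) (c1 t - e1 t)| <= L * D * M.
    apply: le_trans (Q_bound Pc _ _) _.
    by rewrite ler_pM// ?mulr_ge0// ler_wpM2l.
  have T3 : `|Q (c t) (e1 t) (e1 t) - Q (e t) (e1 t) (e1 t)| <= L * M * D * D.
    apply: le_trans (Q_lip Pc Pe _ _) _.
    by rewrite ler_pM// ?mulr_ge0// ler_pM// ?mulr_ge0// ler_wpM2l.
  have T4 : `|a (c t) (e2 t) - a (e t) (e2 t)| <= L * M * (2 * L * D ^+ 2).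
    apply: le_trans (a_lip Pc Pe _) _.
    by rewrite ler_pM// ?mulr_ge0// ler_wpM2l.
  apply: (@le_trans _ _ (2 * (L * M * D + L * D * M + L * M * D * D
                     + L * M * (2 * L * D ^+ 2)))).
    rewrite ler_wpM2l//; apply: le_trans (ler_normB _ _) _.
    rewrite normrN lerD//; apply: le_trans (ler_normD _ _) _.
    rewrite lerD//; apply: le_trans (ler_normD _ _) _.
    exact: lerD.
  have -> : 2 * (L * M * D + L * D * M + L * M * D * D
      + L * M * (2 * L * D ^+ 2)) =
      (2 * (2 * L + L * D + 2 * L ^+ 2 * D) * D) * M by ring.
  rewrite [leRHS]mulrC ler_wpM2r//.
  have LL : L <= L ^+ 2 by rewrite expr2 ler_peMr.
  have LD : L * D <= L by rewrite ler_piMr.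
  have L2D : L ^+ 2 * D <= L ^+ 2 by rewrite ler_piMr// sqr_ge0.
  (* 5 = 2 + 1 + 2, because 1 <= L and D <= 1 bound every monomial in the bracket by a multiple of
     L^2. *)
  have : (2 * L + L * D + 2 * L ^+ 2 * D) * D <= 5 * L ^+ 2 * D.
    rewrite ler_wpM2r//; lra.
  lra.
have [] := dirichlet_bound (lexx 0) d0 d1 dd dd1 d2_0 z01.
by rewrite normr_le0 subr_eq0 => /eqP.
Qed.

End Geodesic.
End ODE.

(** * Basic facts on deformations *)

Lemma near_eq_differentiable {R : realType} {U W : normedModType R}
    (f g : U -> W) x :
  {near x, f =1 g} -> differentiable f x -> differentiable g x.
Proof.
move=> fg df; have fgx := nbhs_singleton fg.
have fg0 : \forall h \near (0 : U), f (h + x) = g (h + x).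
  by move: fg; rewrite (near_shift 0) subr0.
have cdf := diff_continuous df.
have dg : g \o shift x = cst (g x) + 'd f x +o_ 0 id.
  apply/eqaddoP => e e0; have /eqaddoP/(_ e e0) := diff_locally df.
  apply: filterS2 fg0 => h fgh.
  by rewrite !fctE /= -fgh -fgx.
by apply/diff_locallyP; rewrite (diff_unique cdf dg).
Qed.

Lemma near_eq_diff {R : realType} {U W : normedModType R} (f g : U -> W) x :
  {near x, f =1 g} -> differentiable f x -> 'd f x =1 'd g x.
Proof.
move=> fg df v; have dg := near_eq_differentiable fg df.
by rewrite -!deriveE//; exact: near_eq_derive.
Qed.

Lemma differentiable_pairr {R : realType} {U W : normedModType R} (x : U)
  (v : W) : differentiable (pair x) v.
Proof.
have did : differentiable (@id W) v by exact: ex_diff.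
exact: (differentiable_pair (differentiable_cst x v) did).
Qed.

Lemma diff_idE {R : realType} {W : normedModType R} (x v : W) :
  'd (@id W) x v = v.
Proof. by rewrite diff_val. Qed.

Section Deformation.
Context {R : realType} {n : nat} {T : normedModType R}.
Local Notation V := ('rV[R]_n).
Variables (X : set V) (D : deformation T X).

Local Notation U := (fun p : V * V => D p.1 p.2).

Lemma dimgP x t : dimg D x t <-> exists2 v, ddom D (x, v) & D x v = t.
Proof.
split=> [[v /xsectionP Dv <-]|[v Dv <-]]; first by exists v.
by exists v => //; exact/xsectionP.
Qed.

Lemma dmapK x v : ddom D (x, v) -> dinv D x (D x v) = v.
Proof.
move=> Dv; apply: pinvKV; last by rewrite mem_xsection inE.
exact/dmap_inj/(ddom_sub Dv).
Qed.

Lemma dinvK x t : dimg D x t -> D x (dinv D x t) = t.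
Proof. by move=> Dt; apply: pinvK; rewrite inE. Qed.

Lemma ddom_dinv x t : dimg D x t -> ddom D (x, dinv D x t).
Proof. by move=> /dimgP[v Dv <-]; rewrite dmapK. Qed.

Lemma dimg_sub x t : dimg D x t -> X x.
Proof. by move=> /dimgP[v /ddom_sub]. Qed.

Lemma dimg0 x : X x -> dimg D x 0.
Proof.
by move=> Xx; apply/dimgP; exists 0; [exact: ddom0|exact: dmap0].
Qed.

Lemma dinv0 x : X x -> dinv D x 0 = 0.
Proof. by move=> Xx; rewrite -(dmap0 D Xx) dmapK//; exact: ddom0. Qed.

Lemma near_dimg x t : dimg D x t -> \forall t' \near t, dimg D x t'.
Proof.
move=> Dt; apply: (@open_nbhs_nbhs _ t (dimg D x)); split => //.
exact/dimg_open/(dimg_sub Dt).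
Qed.

Lemma near_ddom p : ddom D p -> \forall q \near p, ddom D q.
Proof.
move=> Dp; apply: (@open_nbhs_nbhs _ p (ddom D)); split => //.
exact: ddom_open.
Qed.

Lemma pair_continuous (x v : V) : {for v, continuous (pair x)}.
Proof.
apply: differentiable_continuous.
exact: differentiable_pairr.
Qed.

Lemma near_ddomr x v : ddom D (x, v) -> \forall w \near v, ddom D (x, w).
Proof. by move=> /near_ddom /(pair_continuous). Qed.

Lemma differentiable_dinv x t : dimg D x t -> differentiable (dinv D x) t.
Proof.
by move=> Dt; have [dK _] := dinv_smooth D (dimg_sub Dt) 1; exact: dK.
Qed.

Lemma dmap_C2 p u v : ddom D p ->
  [/\ differentiable U p, differentiable ('D_v U) p &
      differentiable ('D_u ('D_v U)) p].
Proof.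
move=> Dp; have [dU /(_ v)[dU1 /(_ u)[dU2 _]]] := dmap_smooth D 3.
by split; [exact: dU|exact: dU1|exact: dU2].
Qed.

Lemma dmap_C3_continuous p u v w : ddom D p ->
  [/\ {for p, continuous ('D_v U)}, {for p, continuous ('D_u ('D_v U))} &
      {for p, continuous ('D_w ('D_u ('D_v U)))}].
Proof.
move=> Dp; have [_ dU1 dU2] := dmap_C2 u v Dp.
split; [exact: differentiable_continuous|exact: differentiable_continuous|].
have [_ /(_ v)[_ /(_ u)[_ /(_ w) cU]]] := dmap_smooth D 3.
exact: cU.
Qed.

(** Smoothness is given for the joint map on pairs, so derivatives of H_x are read as its
    derivatives along (0, v); their regularity in [x] then comes for free. *)
Lemma derive_dmap x v w : 'D_v (D x) w = 'D_(0, v) U (x, w).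
Proof.
rewrite /derive.
set f := fun h : R => _; set g := fun h : R => _.
suff -> : f = g by [].
by apply/funext => h; rewrite /f /g /= scaler0 add0r.
Qed.

Lemma differentiable_dmap x v : ddom D (x, v) -> differentiable (D x) v.
Proof.
move=> Dv; have [dU _ _] := dmap_C2 0 0 Dv.
exact: (differentiable_comp (differentiable_pairr x v) dU).
Qed.

Lemma coef_hE x v : X x -> coef_h D x v = 'D_(0, v) U (x, 0).
Proof.
move=> /(ddom0 D) D0; rewrite /coef_h -deriveE; last exact: differentiable_dmap.
by rewrite derive_dmap.
Qed.

Lemma D2_dmapE x u v : D2 (D x) 0 u v = 'D_(0, u) ('D_(0, v) U) (x, 0).
Proof.
rewrite /D2.
have -> : 'D_v (D x) = fun w => 'D_(0, v) U (x, w).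
  by apply/funext => w; exact: derive_dmap.
rewrite [LHS]/derive [RHS]/derive.
set f := fun h : R => _; set g := fun h : R => _.
suff -> : f = g by [].
apply/funext => h; rewrite /f /g /=.
by have -> : h *: ((0, u) : V * V) + (x, 0) = (x, h *: u + 0)
  by rewrite -[LHS]/(_, _) /= scaler0 add0r.
Qed.

Lemma coef_h_sum x v : X x ->
  coef_h D x v = \sum_j v 0 j *: 'D_(0, delta_mx 0 j) U (x, 0).
Proof.
move=> Xx; have D0 := differentiable_dmap (ddom0 D Xx).
rewrite /coef_h -deriveE// derive_basis//; apply: eq_bigr => j _.
by rewrite derive_dmap.
Qed.

Lemma coef_hK x v : X x -> coef_k D x (coef_h D x v) = v.
Proof.
move=> Xx; have D0 := ddom0 D Xx.
have dD := differentiable_dmap D0; have dK := differentiable_dinv (dimg0 Xx).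
have DK : {near (0 : V), dinv D x \o D x =1 id}.
  by near=> w; apply: dmapK; near: w; exact: near_ddomr.
have D0x : D x 0 = 0 := dmap0 D Xx.
have dK' : differentiable (dinv D x) (D x 0) by rewrite D0x.
have E1 := near_eq_diff DK (differentiable_comp dD dK') v.
have E2 := congr1 (fun f : V -> V => f v) (diff_comp dD dK').
rewrite /= D0x in E2.
exact: etrans (esym E2) (etrans E1 (diff_idE _ _)).
Unshelve. all: by end_near. Qed.

Lemma coef_kK x t : X x -> coef_h D x (coef_k D x t) = t.
Proof.
move=> Xx; have D0 := ddom0 D Xx.
have dD := differentiable_dmap D0; have dK := differentiable_dinv (dimg0 Xx).
have DK : {near (0 : T), D x \o dinv D x =1 id}.
  by near=> s; apply: dinvK; near: s; exact/near_dimg/dimg0.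
have dD' : differentiable (D x) (dinv D x 0) by rewrite dinv0.
have E1 := near_eq_diff DK (differentiable_comp dK dD') t.
have E2 := congr1 (fun f : T -> T => f t) (diff_comp dK dD').
rewrite /= dinv0// in E2.
exact: etrans (esym E2) (etrans E1 (diff_idE _ _)).
Unshelve. all: by end_near. Qed.

(** The norm of [T] is arbitrary; [k0] carries all estimates to row vectors, and its injectivity
    carries the resulting equalities back. *)
Lemma coef_k_chart x : X x -> exists k0 : {linear T -> V},
  [/\ continuous k0, forall v, k0 (coef_h D x v) = v & injective k0].
Proof.
move=> Xx; exists ('d (dinv D x) (0 : T)); split=> [|v|].
- exact/diff_continuous/differentiable_dinv/dimg0.
- exact: coef_hK.
- by apply: (can_inj (g := coef_h D x)) => t; exact: coef_kK.
Qed.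

End Deformation.

Lemma near_eq_continuous {U W : topologicalType} (f g : U -> W) x :
  {near x, f =1 g} -> {for x, continuous f} -> {for x, continuous g}.
Proof.
move=> fg; rewrite /prop_for /continuous_at -(nbhs_singleton fg).
by apply: cvg_trans; apply: near_eq_cvg; apply: filterS fg => y ->.
Qed.

(** * Local estimates *)

Section Chart.
Context {R : realType} {n : nat} {T : normedModType R}.
Local Notation V := ('rV[R]_n).
Variables (k0 : {linear T -> V}) (k0_cont : continuous k0).

Lemma derive_pairr {W : normedModType R} (g : V * V -> W) p v :
  differentiable g p ->
  'D_(0, v) g p = \sum_j v 0 j *: 'D_(0, delta_mx 0 j) g p.
Proof.
move=> dg; rewrite deriveE//.
have -> : ((0, v) : V * V) = \sum_j v 0 j *: ((0, delta_mx 0 j) : V * V).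
  rewrite {1}(row_sum_delta v).
  have pD (a b : V) : ((0, a + b) : V * V) = (0, a) + (0, b).
    by rewrite -[RHS]/(_, _) /= addr0.
  rewrite (big_morph (fun w : V => (0, w) : V * V) pD (erefl _)).
  by apply: eq_bigr => j _; rewrite -[RHS]/(_, _) /= scaler0.
rewrite linear_sum; apply: eq_bigr => j _; rewrite linearZ -deriveE//.
Qed.

Lemma differentiable_linear_comp {W : normedModType R} (g : W -> T) p :
  differentiable g p -> differentiable (k0 \o g) p.
Proof.
by move=> dg; apply: differentiable_comp => //; exact: linear_differentiable.
Qed.

Lemma derive_linear_comp {W : normedModType R} (g : W -> T) p v :
  differentiable g p -> 'D_v (k0 \o g) p = k0 ('D_v g p).
Proof.
move=> dg; rewrite !deriveE//; last exact: differentiable_linear_comp.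
have dk : differentiable k0 (g p) by exact: linear_differentiable.
have := congr1 (fun f : W -> V => f v) (diff_comp dg dk) => /= ->.
exact: (congr1 (fun f : T -> V => f ('d g p v)) (diff_lin _ k0_cont)).
Qed.

Lemma is_derive_linear_comp (g : V * V -> T) x (z : R -> V) dz (t : R) :
  is_derive t 1 z dz -> differentiable g (x, z t) ->
  is_derive t 1 (fun t => k0 (g (x, z t)))
    (\sum_j dz 0 j *: k0 ('D_(0, delta_mx 0 j) g (x, z t))).
Proof.
move=> dzt dg.
have := is_derive_comp_curve (is_derive_pairr x dzt)
  (differentiable_linear_comp dg).
rewrite derive_linear_comp// derive_pairr// linear_sum.
by under eq_bigr do rewrite linearZ.
Qed.

(** h_x and D^2 H_x(0) are derivatives of the joint map restricted to the zero section. Their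
    Lipschitz dependence on [x] costs one more derivative, hence three in all. *)
Lemma section_lipschitz (g : V * V -> T) x0 :
  (\forall p \near (x0, 0), differentiable g p) ->
  (forall w, {for (x0, 0), continuous ('D_w g)}) ->
  exists2 L, 0 <= L & \forall p \near (x0, x0),
    `|k0 (g (p.1, 0)) - k0 (g (p.2, 0))| <= L * `|p.1 - p.2|.
Proof.
move=> dg cg; pose i (x : V) : V * V := (x, 0).
have di x : differentiable i x.
  have did : differentiable (@id V) x by exact: ex_diff.
  exact: (differentiable_pair did (differentiable_cst 0 x)).
have ci x : {for x, continuous i} by exact: differentiable_continuous.
have dgi : \forall x \near x0, differentiable g (i x) by move: dg => /(ci x0).
have Dgi w : \forall x \near x0,
    k0 ('D_(w, 0) g (i x)) = 'D_w (k0 \o (g \o i)) x.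
  apply: filterS dgi => x dgx; rewrite derive_linear_comp; last first.
    exact: differentiable_comp.
  congr (k0 _); rewrite /derive.
  set f1 := fun h : R => _; set f2 := fun h : R => _.
  suff -> : f1 = f2 by [].
  apply/funext => h; rewrite /f1 /f2 /i /=.
  by have -> : h *: ((w, 0) : V * V) + (x, 0) = (h *: w + x, 0)
    by rewrite -[LHS]/(_, _) /= scaler0 addr0.
apply: (@C1_lipschitz _ _ _ (k0 \o (g \o i))) => [|w].
  apply: filterS dgi => x dgx; apply: differentiable_linear_comp.
  exact: differentiable_comp.
apply: near_eq_continuous (Dgi w) _.
apply: (@continuous_comp _ _ _ (fun x => 'D_(w, 0) g (i x)) k0).
  2: exact: k0_cont.
apply: (@continuous_comp _ _ _ i ('D_(w, 0) g)); [exact: ci|exact: cg].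
Qed.

Variables (X : set V) (D : deformation T X).
Local Notation U := (fun p : V * V => D p.1 p.2).

(* [k0] is [coef_k _ x0] at the center [x0] of the chart, also when [x] varies:
   it is the same for the two deformations to be compared. *)
Definition chart_d1 j p : V := k0 ('D_(0, delta_mx 0 j) U p).
Definition chart_a j x : V := chart_d1 j (x, 0).
Definition chart_b i j x : V :=
  k0 ('D_(0, delta_mx 0 i) ('D_(0, delta_mx 0 j) U) (x, 0)).

(** The last three bounds, with [chart_id] at v = 0, are those required by [geodesic_unique].
    [chart_id] is asked for all small [v] because it must also control H_x itself, through the mean
    value theorem. *)
Record chart_bounds x0 (r L : R) : Prop := ChartBounds {
  chart_r0 : 0 < r;
  chart_L1 : 1 <= L;
  chart_ddom : forall x v, ball x0 r x -> `|v| < r -> ddom D (x, v);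
  chart_id : forall x v, ball x0 r x -> `|v| < r -> forall u : V,
    `|\sum_j u 0 j *: chart_d1 j (x, v) - u| <= 2^-1 * `|u|;
  chart_a_lip : forall x y, ball x0 r x -> ball x0 r y -> forall u,
    `|lin_at chart_a x u - lin_at chart_a y u| <= L * `|x - y| * `|u|;
  chart_b_bound : forall x, ball x0 r x -> forall u v,
    `|bilin_at chart_b x u v| <= L * `|u| * `|v|;
  chart_b_lip : forall x y, ball x0 r x -> ball x0 r y -> forall u v,
    `|bilin_at chart_b x u v - bilin_at chart_b y u v|
      <= L * `|x - y| * `|u| * `|v|
}.

Lemma chart_boundsW x0 (r r' L L' : R) : 0 < r' -> r' <= r -> L <= L' ->
  chart_bounds x0 r L -> chart_bounds x0 r' L'.
Proof.
move=> r'0 r'r LL' [r0 L1 dd id_ al bb bl].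
have br x : ball x0 r' x -> ball x0 r x by exact: le_ball.
split => //; first exact: le_trans LL'.
- by move=> x v /br bx vr; apply: dd => //; exact: lt_le_trans r'r.
- by move=> x v /br bx vr; apply: id_ => //; exact: lt_le_trans r'r.
- move=> x y /br bx /br by_ u; apply: le_trans (al _ _ bx by_ u) _.
  by rewrite !ler_wpM2r.
- move=> x /br bx u v; apply: le_trans (bb _ bx u v) _.
  by rewrite !ler_wpM2r.
- move=> x y /br bx /br by_ u v; apply: le_trans (bl _ _ bx by_ u v) _.
  by rewrite !ler_wpM2r.
Qed.

Lemma lin_atB A (x y u : V) :
  lin_at A x u - lin_at A y u = \sum_j u 0 j *: (A j x - A j y).
Proof. by rewrite /lin_at -sumrB; apply: eq_bigr => j _; rewrite scalerBr. Qed.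

Lemma bilin_at_lin B (x u v : V) :
  bilin_at B x u v = \sum_i u 0 i *: \sum_j v 0 j *: B i j x.
Proof.
rewrite /bilin_at; apply: eq_bigr => i _; rewrite scaler_sumr.
by apply: eq_bigr => j _; rewrite scalerA.
Qed.

Lemma bilin_at_le B (x u v : V) (M : 'I_n -> 'I_n -> R) :
  (forall i j, `|B i j x| <= M i j) ->
  `|bilin_at B x u v| <= `|u| * (`|v| * \sum_i \sum_j M i j).
Proof.
move=> BM; rewrite bilin_at_lin.
have := @norm_lincomb_le _ _ V u (fun i => \sum_j v 0 j *: B i j x)
  (fun i => `|v| * \sum_j M i j).
rewrite -mulr_sumr; apply => i; exact: norm_lincomb_le.
Qed.

(** Through [k0] the derivative of H_x at [v] is the identity for (x, v) = (x0, 0), hence close to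
    it nearby; the other bounds come from [section_lipschitz]. *)
Lemma chart_boundsP x0 : X x0 ->
  (forall v, k0 (coef_h D x0 v) = v) ->
  exists r L, chart_bounds x0 r L.
Proof.
move=> Xx0 k0h.
have D0 := ddom0 D Xx0.
have d1 : forall j, exists L, 0 <= L /\ \forall p \near (x0, x0),
    `|chart_a j p.1 - chart_a j p.2| <= L * `|p.1 - p.2|.
  move=> j; have [||L L0 HL] := @section_lipschitz ('D_(0, delta_mx 0 j) U) x0.
  - apply: filterS (near_ddom D0) => p Dp.
    by have [_ + _] := dmap_C2 0 (0, delta_mx 0 j) Dp.
  - by move=> w; have [_ + _] := dmap_C3_continuous w (0, delta_mx 0 j) 0 D0.
  - by exists L.
have d2 : forall ij, exists L, 0 <= L /\ \forall p \near (x0, x0),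
    `|chart_b ij.1 ij.2 p.1 - chart_b ij.1 ij.2 p.2| <= L * `|p.1 - p.2|.
  move=> [i j]; have [||L L0 HL] := @section_lipschitz
    ('D_(0, delta_mx 0 i) ('D_(0, delta_mx 0 j) U)) x0.
  - apply: filterS (near_ddom D0) => p Dp.
    by have [_ _ +] := dmap_C2 (0, delta_mx 0 i) (0, delta_mx 0 j) Dp.
  - move=> w.
    by have [_ _ +] :=
      dmap_C3_continuous (0, delta_mx 0 i) (0, delta_mx 0 j) w D0.
  - by exists L.
have [La /all_and2[La0 HLa]] := choice d1.
have [Lb /all_and2[Lb0 HLb]] := choice d2.
have near_a : \forall p \near (x0, x0), forall j,
    `|chart_a j p.1 - chart_a j p.2| <= La j * `|p.1 - p.2|.
  exact: filter_forall HLa.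
have near_b : \forall p \near (x0, x0), forall ij,
    `|chart_b ij.1 ij.2 p.1 - chart_b ij.1 ij.2 p.2| <= Lb ij * `|p.1 - p.2|.
  exact: filter_forall HLb.
(* The errors of the n columns add up to at most n c <= 1/2; the successor keeps the denominator
   nonzero when n = 0. *)
pose c : R := (2 * n.+1%:R)^-1.
have c0 : 0 < c by rewrite invr_gt0 mulr_gt0.
have near_d1 j :
    \forall p \near (x0, 0 : V), `|chart_d1 j p - delta_mx 0 j| <= c.
  have [cU _ _] := dmap_C3_continuous 0 (0, delta_mx 0 j) 0 D0.
  have ck : {for (x0, 0 : V), continuous (chart_d1 j)}.
    apply: (@continuous_comp _ _ _ ('D_(0, delta_mx 0 j) U) k0 _ cU).
    exact: k0_cont.
  have E : chart_d1 j (x0, 0) = delta_mx 0 j.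
    by rewrite /chart_d1 -coef_hE// k0h.
  move/cvgrPdist_le: ck => /(_ _ c0); rewrite E.
  by apply: filterS => p; rewrite distrC.
have near_id : \forall p \near (x0, 0 : V), ddom D p /\
    forall j, `|chart_d1 j p - delta_mx 0 j| <= c.
  by apply: filterI; [exact: near_ddom|exact: filter_forall near_d1].
have /nbhs_ballP[ra /= ra0 Ha] := near_a.
have /nbhs_ballP[rb /= rb0 Hb] := near_b.
have /nbhs_ballP[ri /= ri0 Hi] := near_id.
have {}Ha x y : ball x0 ra x -> ball x0 ra y -> forall j,
    `|chart_a j x - chart_a j y| <= La j * `|x - y|.
  by move=> bx by_; exact: (Ha (x, y)).
have {}Hb x y : ball x0 rb x -> ball x0 rb y -> forall i j,
    `|chart_b i j x - chart_b i j y| <= Lb (i, j) * `|x - y|.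
  by move=> bx by_ i j; exact: (Hb (x, y) _ (i, j)).
have {}Hi x v : ball x0 ri x -> `|v| < ri -> ddom D (x, v) /\
    forall j, `|chart_d1 j (x, v) - delta_mx 0 j| <= c.
  move=> bx vr; apply: (Hi (x, v)); split => //=.
  by rewrite -ball_normE /= sub0r normrN.
pose r := Num.min ri (Num.min ra (Num.min rb 1)).
have rri : r <= ri by rewrite ge_min lexx.
have rra : r <= ra by rewrite !ge_min lexx !orbT.
have rrb : r <= rb by rewrite !ge_min lexx !orbT.
have r1 : r <= 1 by rewrite !ge_min lexx !orbT.
pose SA := \sum_j La j.
pose SB := \sum_i \sum_j Lb (i, j).
(* Value at the center plus Lipschitz constant times distance, the distance being at most r <= 1. *)
pose M i j := `|chart_b i j x0| + Lb (i, j).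
pose SM := \sum_i \sum_j M i j.
have SA0 : 0 <= SA by apply: sumr_ge0 => j _; exact: La0.
have SB0 : 0 <= SB by do 2!apply: sumr_ge0 => ? _; exact: Lb0.
have SM0 : 0 <= SM.
  by do 2!apply: sumr_ge0 => ? _; rewrite addr_ge0// Lb0.
exists r, (1 + SA + SB + SM); split.
- by rewrite !lt_min ri0 ra0 rb0 ltr01.
- lra.
- move=> x v bx vr; have [] // := Hi x v (le_ball rri bx).
  exact: lt_le_trans rri.
- move=> x v bx vr u.
  have [_ Hj] := Hi x v (le_ball rri bx) (lt_le_trans vr rri).
  rewrite {2}(row_sum_delta u) -sumrB.
  under eq_bigr do rewrite -scalerBr.
  apply: le_trans (norm_lincomb_le _ Hj) _.
  rewrite mulrC ler_wpM2r// sumr_const card_ord -[leLHS]mulr_natl /c invfM.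
  rewrite mulrCA ler_piMr// ler_pdivrMr ?ltr0n// mul1r ler_nat//.
- move=> x y bx by_ u; rewrite lin_atB.
  have := norm_lincomb_le u (Ha x y (le_ball rra bx) (le_ball rra by_)).
  rewrite -mulr_suml => /le_trans; apply.
  rewrite [leLHS]mulrC ler_wpM2r// ler_wpM2r// -/SA; lra.
- move=> x bx u v.
  have BM i j : `|chart_b i j x| <= M i j.
    rewrite -(subrK (chart_b i j x0) (chart_b i j x)) addrC /M.
    apply: le_trans (ler_normD _ _) _; rewrite lerD2l.
    have := Hb x x0 (le_ball rrb bx) (ballxx _ rb0) i j.
    move=> /le_trans; apply; rewrite ler_piMr ?Lb0//.
    apply: le_trans r1; rewrite distrC; apply: ltW.
    by move: bx; rewrite -ball_normE.
  apply: le_trans (bilin_at_le u v BM) _.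
  rewrite -/SM.
  have -> : `|u| * (`|v| * SM) = SM * `|u| * `|v| by ring.
  do 2!rewrite ler_wpM2r//; lra.
- move=> x y bx by_ u v.
  pose B' i j (z : V) := chart_b i j x - chart_b i j y.
  have -> : bilin_at chart_b x u v - bilin_at chart_b y u v = bilin_at B' x u v.
    rewrite /bilin_at -sumrB; apply: eq_bigr => i _; rewrite -sumrB.
    by apply: eq_bigr => j _; rewrite -scalerBr.
  have BM i j : `|B' i j x| <= Lb (i, j) * `|x - y|.
    exact: Hb (le_ball rrb bx) (le_ball rrb by_) i j.
  apply: le_trans (bilin_at_le u v BM) _.
  under eq_bigr do rewrite -mulr_suml.
  rewrite -mulr_suml -/SB.
  have -> : `|u| * (`|v| * (SB * `|x - y|)) = SB * `|x - y| * `|u| * `|v|.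
    by ring.
  do 3!rewrite ler_wpM2r//; lra.
Qed.

End Chart.

(** * Differentiation rules along curves *)

Lemma is_derive_continuous {R : realType} {W : normedModType R} (f : R -> W)
    (s : R) df :
  is_derive s 1 f df -> {for s, continuous f}.
Proof.
move=> [dfs _]; exact/differentiable_continuous/derivable1_diffP.
Qed.

Lemma is_derive_unique {R : realType} {W : normedModType R} (f g : R -> W)
    (s : R) df dg :
  (\forall t \near s, f t = g t) ->
  is_derive s 1 f df -> is_derive s 1 g dg -> df = dg.
Proof.
by move=> fg fs [_ <-]; have [_ ->] := near_eq_is_derive fg fs.
Qed.

Lemma is_derive_scalelB {R : realType} {W : normedModType R} (a : R)
    (d : W) (s : R) :
  is_derive s 1 (fun t => (t - a) *: d) d.
Proof.
have -> : (fun t => (t - a) *: d) = (fun t => - (a *: d) + t *: d).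
  by apply/funext => t; rewrite scalerBl addrC.
exact: is_derive_line.
Qed.

Lemma is_derive_scalel {R : realType} {W : normedModType R} (d : W) (s : R) :
  is_derive s 1 (fun t => t *: d) d.
Proof.
have -> : (fun t => t *: d) = (fun t => (t - 0) *: d).
  by apply/funext => t; rewrite subr0.
exact: is_derive_scalelB.
Qed.

Lemma is_derive_rV {R : realType} {m} (f : R -> 'rV[R]_m) (s : R)
    (df : 'rV[R]_m) :
  (forall j, is_derive s 1 (fun t => f t 0 j) (df 0 j)) -> is_derive s 1 f df.
Proof.
move=> fj; have dfs : derivable f s 1.
  by apply/derivable_mxP => i j; rewrite ord1; apply: ex_derive; exact: fj.
split=> //; rewrite derive_mx//; apply/matrixP => i j; rewrite mxE ord1.
by have [_ ->] := fj j.
Qed.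

Lemma is_derive_scale {R : realType} {m} (f : R -> R) (g : R -> 'rV[R]_m)
    (s : R) df dg :
  is_derive s 1 f df -> is_derive s 1 g dg ->
  is_derive s 1 (fun t => f t *: g t) (df *: g s + f s *: dg).
Proof.
move=> fs gs; apply: is_derive_rV => j.
have -> : (fun t => (f t *: g t) 0 j) = f * (fun t => g t 0 j).
  by apply/funext => t; rewrite mxE.
have gsj := is_derive_coord j gs.
apply: (is_derive_eq (is_deriveM fs gsj)).
by rewrite !mxE addrC; congr (_ + _); rewrite /= mulrC.
Qed.

Lemma is_derive_bigsum {R : realType} {W : normedModType R} {m}
    (f : 'I_m -> R -> W) (s : R) (df : 'I_m -> W) :
  (forall j, is_derive s 1 (f j) (df j)) ->
  is_derive s 1 (fun t => \sum_j f j t) (\sum_j df j).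
Proof.
move=> fs; have -> : (fun t => \sum_j f j t) = \sum_j f j.
  by apply/funext => t; rewrite fct_sumE.
exact: is_derive_sum.
Qed.

Lemma is_derive_comp_mull {R : realType} {W : normedModType R} (f : R -> W)
    (S s : R) df :
  is_derive (S * s) 1 f df -> is_derive s 1 (fun t => f (S * t)) (S *: df).
Proof.
move=> [dfs <-]; have dff : differentiable f (S * s) by exact/derivable1_diffP.
have dS : is_derive s 1 (fun t : R => S * t) S.
  have := is_derive_scalel (S : R^o) s.
  by under eq_fun do rewrite [_ *: _]mulrC.
have := is_derive_comp_curve dS dff; rewrite !deriveE//.
by rewrite -[X in 'd f _ X]mulr1 -[S * 1]/(S *: 1) linearZ.
Qed.

(** * Canonical curves are geodesics *)

Section Curve.
Context {R : realType} {n : nat} {T : normedModType R}.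
Local Notation V := ('rV[R]_n).
Variables (X : set V) (D : deformation T X).
Local Notation U := (fun p : V * V => D p.1 p.2).

(** Mean value theorem for v |-> k0 (H_x v) - v, whose derivative has norm at most 1/2 by
    [chart_id]. *)
Lemma chart_near_id (k0 : {linear T -> V}) (k0_cont : continuous k0) x0 r L :
  chart_bounds k0 D x0 r L ->
  forall x v w, ball x0 r x -> `|v| < r -> `|w| < r ->
  `|k0 (D x v) - k0 (D x w) - (v - w)| <= 2^-1 * `|v - w|.
Proof.
move=> B x v w bx vr wr.
pose z s := w + s *: (v - w).
have zr (s : R) : s \in `[0, 1] -> `|z s| < r.
  move=> s01; have -> : z s = s *: v + (1 - s) *: w.
    by apply/matrixP => i j; rewrite /z !mxE; ring.
  exact: norm_segment_lt.
pose df s := \sum_j (v - w) 0 j *: chart_d1 k0 D j (x, z s) - (v - w).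
have dz (s : R) : s \in `[0, 1] ->
    is_derive s 1 (fun s => k0 (D x (z s)) - s *: (v - w)) (df s).
  move=> s01; apply: (is_deriveB _ (is_derive_scalel _ _)).
  have [|dU _ _] := @dmap_C2 _ _ _ _ D (x, z s) 0 0.
    by apply: (chart_ddom B) => //; exact: zr.
  by have := is_derive_linear_comp k0_cont (is_derive_line w (v - w) s) dU.
have df_le (s : R) : s \in `]0, 1[ -> `|df s| <= 2^-1 * `|v - w|.
  by move=> /subset_itv_oo_cc s01; apply: (chart_id B) => //; exact: zr.
have M0 : 0 <= 2^-1 * `|v - w| by rewrite mulr_ge0.
have := MVT_rV ler01 M0 dz df_le.
rewrite /z !scale1r !scale0r !addr0 !subr0 mulr1 (addrC w) subrK.
by rewrite addrAC.
Qed.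

Lemma chart_norm_le (k0 : {linear T -> V}) (k0_cont : continuous k0) x0 r L :
  chart_bounds k0 D x0 r L ->
  forall x v, ball x0 r x -> `|v| < r -> `|k0 (D x v) - v| <= 2^-1 * `|v|.
Proof.
move=> B x v bx vr; have r0 : `|0 : V| < r by rewrite normr0 (chart_r0 B).
have Xx : X x by exact: ddom_sub (chart_ddom B bx r0).
have := chart_near_id k0_cont B bx vr r0.
by rewrite (dmap0 D Xx) linear0 !subr0.
Qed.

Lemma lin_at_chart_a (k0 : {linear T -> V}) z u : X z ->
  lin_at (chart_a k0 D) z u = k0 (coef_h D z u).
Proof.
move=> Xz; rewrite coef_h_sum// linear_sum.
by apply: eq_bigr => j _; rewrite linearZ.
Qed.

Lemma coef_hZ z (a : R) u : coef_h D z (a *: u) = a *: coef_h D z u.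
Proof. exact: linearZ. Qed.

Variables (x x' : V) (S : R) (I : set R) (c : R -> V).
Hypothesis cc : canonical_curve D x x' S I c.

Let tau s := coef_h D (c s) (derive1 c s).
Let y s := x + dinv D x (s *: tau 0).
Let dy s := 'D_(tau 0) (dinv D x) (s *: tau 0).

Let S0 : 0 <= S. Proof. by case: cc => -[]. Qed.
Let c0 : c 0 = x. Proof. by case: cc => _ []. Qed.
Let cS : c S = x'. Proof. by case: cc => _ []. Qed.
Let Xc s : s \in `[0, S] -> X (c s).
Proof. by case: cc => _ [_ _ +] _ _; exact. Qed.
Let tau_dimg s : s \in `[0, S] -> dimg D x (s *: tau 0).
Proof. by case: cc => _ _ + _; exact. Qed.
Let z0S : 0 \in `[0, S]. Proof. by rewrite in_itv/= lexx S0. Qed.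
Let Xx : X x. Proof. by rewrite -c0; exact: Xc. Qed.

Let Ic s : s \in `[0, S] -> I s.
Proof. by move=> sS; case: cc => -[_ _ + _] _ _ _; apply. Qed.

Let cphi (s s' : R) : s \in `[0, S] -> s + s' \in `[0, S] ->
  phi_defined D x (s *: tau 0) (s' *: tau s) ->
  phi D x (s *: tau 0) (s' *: tau s) = (s + s') *: tau 0.
Proof. by case: cc => _ _ _; apply. Qed.

Lemma canonical_curve_derive (s : R) :
  s \in `[0, S] -> is_derive s 1 c (derive1 c s).
Proof.
move=> sS; have [dc _] : Ck 1 I c by case: cc => -[].
by rewrite derive1E; apply/derivableP/derivable1_diffP/dc/Ic.
Qed.

Lemma canonical_curve_derive2 (s : R) :
  s \in `[0, S] -> is_derive s 1 (derive1 c) (derive1 (derive1 c) s).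
Proof.
move=> sS; have [_ /(_ 1)[dc _]] : Ck 2 I c by case: cc => -[].
have -> : derive1 c = 'D_1 c by apply/funext => t; exact: derive1E.
by rewrite derive1E; apply/derivableP/derivable1_diffP/dc/Ic.
Qed.

Lemma orbit_derive (s : R) : s \in `[0, S] -> is_derive s 1 y (dy s).
Proof.
move=> sS; have dK := differentiable_dinv (tau_dimg sS).
have := is_derive_comp_curve (is_derive_scalel (tau 0) s) dK.
by move=> /(is_deriveD (is_derive_cst x s 1)); rewrite add0r.
Qed.

(** Canonicity with s' = t - s, after applying K_x. For [t] near [s] the second factor is small, so
    the product is defined. Note the mismatch: K is taken at [y s] but [tau s] at [c s], until the
    two points are identified. *)
Lemma orbit_local (s : R) : s \in `[0, S] -> X (y s) ->
  \forall t \near s, t \in `[0, S] ->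
    dimg D (y s) ((t - s) *: tau s) /\
    y t = y s + dinv D (y s) ((t - s) *: tau s).
Proof.
move=> sS Xy.
pose z t := (t - s) *: tau s.
have cz : {for s, continuous z}.
  exact: is_derive_continuous (is_derive_scalelB _ _ _).
have z0 : z s = 0 by rewrite /z subrr scale0r.
have dz : \forall t \near s, dimg D (y s) (z t).
  apply: (cz (dimg D (y s))); rewrite z0; exact/near_dimg/dimg0.
have cK : {for s, continuous
    (fun t => dinv D x (s *: tau 0) + dinv D (y s) (z t))}.
  apply: continuousD; first exact: cst_continuous.
  apply: (@continuous_comp _ _ _ z (dinv D (y s))); first exact: cz.
  by rewrite z0; exact/differentiable_continuous/differentiable_dinv/dimg0.
have dd : \forall t \near s,
    ddom D (x, dinv D x (s *: tau 0) + dinv D (y s) (z t)).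
  apply: (cK (fun v => ddom D (x, v))).
  rewrite z0 dinv0// addr0; exact/near_ddomr/ddom_dinv/tau_dimg.
near=> t => tS.
have dzt : dimg D (y s) (z t) by near: t.
have ddt : ddom D (x, dinv D x (s *: tau 0) + dinv D (y s) (z t)) by near: t.
split; first exact: dzt.
have st : s + (t - s) = t by rewrite addrC subrK.
have tS' : s + (t - s) \in `[0, S] by rewrite st.
have phid : phi_defined D x (s *: tau 0) ((t - s) *: tau s).
  exact: And3 (tau_dimg sS) dzt ddt.
have phiE := cphi sS tS' phid; rewrite st in phiE.
by rewrite /y -phiE (dmapK ddt) addrA.
Unshelve. all: by end_near. Qed.

Lemma near_itv_oo (a b s : R) :
  s \in `]a, b[ -> \forall t \near s, t \in `[a, b].
Proof.
move=> sab; near=> t; apply: subset_itv_oo_cc; near: t.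
exact: near_in_itvoo.
Unshelve. all: by end_near. Qed.

(** Differentiating [orbit_local] at t = s gives y' = k_y(tau_s). *)
Lemma orbit_velocity (s : R) : s \in `]0, S[ -> X (y s) ->
  coef_h D (y s) (dy s) = tau s.
Proof.
move=> sS Xy; have sS' := subset_itv_oo_cc sS.
have yE : \forall t \near s, y t = y s + dinv D (y s) ((t - s) *: tau s).
  near=> t; have tS : t \in `[0, S] by near: t; exact: near_itv_oo.
  by have [] : dimg D (y s) ((t - s) *: tau s) /\
    y t = y s + dinv D (y s) ((t - s) *: tau s)
    by move: tS; near: t; exact: orbit_local.
have z0 : (s - s) *: tau s = 0 by rewrite subrr scale0r.
have dK : differentiable (dinv D (y s)) ((s - s) *: tau s).
  by rewrite z0; exact/differentiable_dinv/dimg0.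
have d2 : is_derive s 1 (fun t => y s + dinv D (y s) ((t - s) *: tau s))
    (coef_k D (y s) (tau s)).
  have := is_derive_comp_curve (is_derive_scalelB s (tau s) s) dK.
  move=> /(is_deriveD (is_derive_cst (y s) s 1)); rewrite add0r deriveE// z0.
  exact.
by rewrite (is_derive_unique yE (orbit_derive sS') d2) coef_kK.
Unshelve. all: by end_near. Qed.

(* Both [y] and [c] solve [coef_h D z z' = tau s]: for [y] this comes from
   [orbit_local], differentiated at [t = s]; for [c] it defines [tau]. *)
Lemma orbit_eq (s : R) : s \in `[0, S] -> y s = c s.
Proof.
move: s; apply: (@real_induction _ (fun s => y s = c s) S S0).
- by rewrite /y scale0r dinv0// addr0 c0.
- move=> s /andP[s0 sS] yc; set p := c s.
  have sS' : s \in `[0, S] by rewrite in_itv/= s0 ltW.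
  have Xp : X p by exact: Xc.
  have [k0 [k0_cont k0h _]] := coef_k_chart D Xp.
  have [r [L B]] := chart_boundsP k0_cont Xp k0h.
  pose K := `|derive1 c s| + 1.
  have L1 := chart_L1 B.
  have L0 : 0 < L by apply: lt_le_trans L1.
  have K0 : 0 < K by rewrite ltr_wpDl.
  have ny : \forall t \near s, ball p r (y t).
    apply: (is_derive_continuous (orbit_derive sS')).
    by rewrite yc; apply: nbhsx_ballx; exact: (chart_r0 B).
  have nc : \forall t \near s, ball p r (c t).
    apply: (is_derive_continuous (canonical_curve_derive sS')).
    by apply: nbhsx_ballx; exact: (chart_r0 B).
  have nd : \forall t \near s, `|derive1 c t| <= K.
    have := is_derive_continuous (canonical_curve_derive2 sS').
    move=> /cvgrPdist_le/(_ 1 ltr01); apply: filterS => t ts.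
    rewrite /K addrC -lerBlDr; apply: le_trans ts; rewrite distrC.
    exact: lerB_dist.
  have /nbhs_ballP[e /= e0 He] : \forall t \near s,
      [/\ ball p r (y t), ball p r (c t) & `|derive1 c t| <= K].
    by near=> t; split; near: t.
  (* This length makes 2 L K (t - s) at most 1/2, as [ode_coincidence] demands. *)
  pose d := Num.min e (4 * L * K)^-1.
  have d0 : 0 < d by rewrite lt_min e0 invr_gt0 !mulr_gt0.
  apply/nbhs_ballP; exists d => //= t; rewrite /ball/= => std st tS.
  have dt q : s <= q <= t -> ball s e q.
    move=> /andP[sq qt]; rewrite /ball/= distrC ger0_norm ?subr_ge0//.
    have : t - s < e.
      move: std; rewrite lt_min distrC ger0_norm ?subr_ge0//.
      by case/andP.
    by apply: le_lt_trans; rewrite lerD2r.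
  have tS0 : t <= S by move: tS; rewrite in_itv/= => /andP[].
  have q0S q : s <= q <= t -> q \in `[0, S].
    by move=> /andP[sq qt]; rewrite in_itv/= (le_trans s0 sq) (le_trans qt).
  have q0So q : q \in `]s, t[ -> q \in `]0, S[.
    rewrite !in_itv/= => /andP[sq qt].
    by rewrite (le_lt_trans s0 sq) (lt_le_trans qt).
  have r00 : `|0 : V| < r by rewrite normr0 (chart_r0 B).
  have bX z : ball p r z -> X z.
    by move=> bz; exact: ddom_sub (chart_ddom B bz r00).
  have aid z : ball p r z -> forall u : V,
      `|lin_at (chart_a k0 D) z u - u| <= 2^-1 * `|u|.
    by move=> bz u; exact: (chart_id B bz r00).
  have LKt : 2 * L * K * (t - s) <= 2^-1.
    have : t - s <= (4 * L * K)^-1.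
      move: std; rewrite lt_min distrC ger0_norm ?subr_ge0//.
      by case/andP => _ /ltW.
    rewrite -[leRHS]div1r ler_pdivlMr ?mulr_gt0//; lra.
  have dyq (q : R) : q \in `[s, t] -> is_derive q 1 y (dy q).
    by move=> qst; apply: orbit_derive; exact: q0S.
  have dcq (q : R) : q \in `[s, t] -> is_derive q 1 c (derive1 c q).
    by move=> qst; apply: canonical_curve_derive; exact: q0S.
  have Pq (q : R) : q \in `[s, t] ->
      [/\ ball p r (y q), ball p r (c q) & `|y q - c q| <= r + r].
    move=> /dt/He[byq bcq _]; split=> //.
    rewrite -(subrKA p); apply: le_trans (ler_normD _ _) _.
    rewrite distrC; move: byq bcq; rewrite -ball_normE /= => /ltW byq /ltW bcq.
    exact: lerD.
  have Kq (q : R) : q \in `]s, t[ -> `|derive1 c q| <= K.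
    by move=> /subset_itv_oo_cc/dt/He[].
  have Eq (q : R) : q \in `]s, t[ ->
      lin_at (chart_a k0 D) (y q) (dy q) =
      lin_at (chart_a k0 D) (c q) (derive1 c q).
    move=> qst; have [byq bcq _] := Pq _ (subset_itv_oo_cc qst).
    rewrite (lin_at_chart_a k0 _ (bX _ byq)) (lin_at_chart_a k0 _ (bX _ bcq)).
    by rewrite (orbit_velocity (q0So _ qst) (bX _ byq)).
  apply: (ode_coincidence L1 aid (chart_a_lip B) (ltW K0) LKt yc dyq dcq Pq Kq).
    exact: Eq.
  by rewrite in_itv/= st lexx.
(* Closedness: if the curves differed at [s], they would differ just before [s] by continuity. *)
- move=> s /andP[s0 sS] yc.
  have sS' : s \in `[0, S] by rewrite in_itv/= ltW.
  apply: contrapT => /eqP ycs.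
  have cyc : {for s, continuous (fun t => y t - c t)}.
    apply: continuousB; [exact: is_derive_continuous (orbit_derive sS')|].
    exact: is_derive_continuous (canonical_curve_derive sS').
  have ycs0 : y s - c s != 0 by rewrite subr_eq0.
  have : \forall t \near s, y t - c t != 0.
    have n0 : 0 < `|y s - c s| by rewrite normr_gt0.
    move/cvgrPdist_lt: cyc => /(_ _ n0); apply: filterS => t.
    by apply: contraPneq => ->; rewrite subr0 ltxx.
  move=> /nbhs_ballP[e /= e0 He].
  pose d := Num.min (e / 2) s.
  have d0 : 0 < d by rewrite lt_min s0 divr_gt0.
  have de : d <= e / 2 by rewrite ge_min lexx.
  have ds : d <= s by rewrite ge_min lexx orbT.
  have : ball s e (s - d) by rewrite /ball/= opprB addrC subrK gtr0_norm//; lra.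
  move=> /He; rewrite subr_eq0 => /eqP; apply; apply: yc.
  by apply/andP; split; lra.
Unshelve. all: by end_near. Qed.

(** * The geodesic equation and the size of the curve in a chart *)

Section Geodesic.
Variables (k0 : {linear T -> V}) (k0_cont : continuous k0) (x0 : V) (r L : R).
Hypothesis B : chart_bounds k0 D x0 r L.

Lemma curve_ray (s : R) : s \in `[0, S] ->
  ddom D (x, c s - x) /\ D x (c s - x) = s *: tau 0.
Proof.
move=> sS; have := orbit_eq sS; rewrite /y => <-.
rewrite addrC addKr; split; first exact/ddom_dinv/tau_dimg.
exact/dinvK/tau_dimg.
Qed.

Lemma curve_local_ray (s : R) : s \in `]0, S[ -> \forall t \near s,
  ddom D (c s, c t - c s) /\ D (c s) (c t - c s) = (t - s) *: tau s.
Proof.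
move=> sS; have sS' := subset_itv_oo_cc sS.
have Xy : X (y s) by rewrite orbit_eq//; exact: Xc.
near=> t; have tS : t \in `[0, S] by near: t; exact: near_itv_oo.
have [dt yt] : dimg D (y s) ((t - s) *: tau s) /\
    y t = y s + dinv D (y s) ((t - s) *: tau s).
  by move: tS; near: t; exact: orbit_local.
have ys := orbit_eq sS'; rewrite ys in dt yt.
rewrite (orbit_eq tS) in yt.
rewrite yt addrC addKr; split; first exact: ddom_dinv.
exact: dinvK.
Unshelve. all: by end_near. Qed.

Lemma geodesic_equation (s : R) : s \in `]0, S[ ->
  lin_at (chart_a k0 D) (c s) (derive1 (derive1 c) s) +
  bilin_at (chart_b k0 D) (c s) (derive1 c s) (derive1 c s) = 0.
Proof.
move=> sS; have sS' := subset_itv_oo_cc sS.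
set p := c s; pose z t := c t - p.
have dz (t : R) : t \in `[0, S] -> is_derive t 1 z (derive1 c t).
  move=> tS; rewrite -[derive1 c t]subr0.
  exact: is_deriveB (canonical_curve_derive tS) (is_derive_cst p t 1).
have z0 : z s = 0 by rewrite /z subrr.
pose v t := \sum_j (derive1 c t) 0 j *: chart_d1 k0 D j (p, z t).
(* [v] is the velocity of t |-> k0 (H_p (c t - p)). The ray identity holds around every [t] close to
   [s] ([near_join]), so it may be differentiated at each such [t], which makes [v] constant near
   [s]. *)
have vE : \forall t \near s, v t = k0 (tau s).
  have := near_join (curve_local_ray sS); apply: filterS2 (near_itv_oo sS).
  move=> t tS rt; have [Dt _] := nbhs_singleton rt.
  have [dU _ _] := dmap_C2 0 0 Dt.
  have d1 := is_derive_linear_comp k0_cont (dz t tS) dU.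
  apply: is_derive_unique d1 (is_derive_scalelB s (k0 (tau s)) t).
  by apply: filterS rt => q [_ /= ->]; rewrite linearZ.
have dv : is_derive s 1 v (\sum_j
    ((derive1 (derive1 c) s) 0 j *: chart_d1 k0 D j (p, z s)
    + (derive1 c s) 0 j *: \sum_i (derive1 c s) 0 i *:
       k0 ('D_(0, delta_mx 0 i) ('D_(0, delta_mx 0 j) U) (p, z s)))).
  apply: is_derive_bigsum => j; apply: is_derive_scale.
    exact/is_derive_coord/canonical_curve_derive2.
  have D0 : ddom D (p, z s) by rewrite z0; exact/ddom0/Xc.
  have [_ dU _] := dmap_C2 0 (0, delta_mx 0 j) D0.
  have H := is_derive_linear_comp k0_cont (dz s sS') dU. exact: H.
have := is_derive_unique vE dv (is_derive_cst _ _ _).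
rewrite z0 => E; rewrite -[RHS]E big_split /=; congr (_ + _).
rewrite /bilin_at exchange_big/=; apply: eq_bigr => j _.
rewrite scaler_sumr; apply: eq_bigr => i _.
by rewrite scalerA mulrC.
Qed.

Hypotheses (x0x : ball x0 (r / 2) x) (ww : 6 * `|x' - x| < r).

Let r0 : 0 < r. Proof. exact: chart_r0 B. Qed.
Let x0rx : ball x0 r x.
Proof. by apply: le_ball x0x; have := chart_r0 B; lra. Qed.

Let wr : `|x' - x| < r.
Proof. by apply: le_lt_trans ww; rewrite ler_peMl// ler1n. Qed.

(** S tau_0 is H_x(x' - x), and the chart form of H_x is within one half of the identity. *)
Lemma curve_speed_le : `|S *: k0 (tau 0)| <= 3 / 2 * `|x' - x|.
Proof.
have zS : S \in `[0, S] by rewrite in_itv/= lexx S0.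
have [_] := curve_ray zS; rewrite cS => E.
rewrite -linearZ -E; have := chart_norm_le k0_cont B x0rx wr.
have := lerB_dist (k0 (D x (x' - x))) (x' - x); lra.
Qed.

(** The lower distortion bound gives |c s - x| <= 2 |s k0(tau_0)|, and 2 times 3/2 is 3. *)
Lemma curve_near_le (s : R) : s \in `[0, S] -> `|c s - x| < r ->
  `|c s - x| <= 3 * `|x' - x|.
Proof.
move=> sS cr; have [_ E] := curve_ray sS.
have := chart_norm_le k0_cont B x0rx cr; rewrite E linearZ.
rewrite distrC => H.
have := lerB_dist (c s - x) (s *: k0 (tau 0)).
have sSS : `|s *: k0 (tau 0)| <= `|S *: k0 (tau 0)|.
  move: sS; rewrite in_itv/= => /andP[s0 sS].
  by rewrite !normrZ !ger0_norm// ler_wpM2r.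
have := curve_speed_le; lra.
Qed.

(* The curve could a priori make a long detour; it does not, since the norm of
   [H_x (c s - x)] is proportional to [s] and controls [c s - x]. *)
Lemma curve_short (s : R) : s \in `[0, S] -> `|c s - x| <= 3 * `|x' - x|.
Proof.
move=> sS; apply: curve_near_le => //; move: s sS.
have w0 := normr_ge0 (x' - x).
have uc (s : R) : s \in `[0, S] -> {for s, continuous (fun t => c t - x)}.
  move=> sS; apply: continuousB; last exact: cst_continuous.
  exact: is_derive_continuous (canonical_curve_derive sS).
apply: (@real_induction _ (fun s => `|c s - x| < r) S S0).
- by rewrite c0 subrr normr0.
- move=> s /andP[s0 sS] sr.
  have sS' : s \in `[0, S] by rewrite in_itv/= s0 ltW.
  have n0 : 0 < r - `|c s - x| by rewrite subr_gt0.
  have /cvgrPdist_lt/(_ _ n0) := uc _ sS'.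
  apply: filterS => t ts _ _.
  have := lerB_dist (c t - x) (c s - x); rewrite distrC; lra.
- move=> s /andP[s0 sS] sr.
  have sS' : s \in `[0, S] by rewrite in_itv/= ltW.
  (* Just before [s] the distance to [x] is at most 3 |x' - x| < r / 2, which is what the 6 in [ww]
     provides; continuity adds less than r / 2. *)
  have n0 : 0 < r / 2 by rewrite divr_gt0.
  have /cvgrPdist_lt/(_ _ n0)/nbhs_ballP[e /= e0 He] := uc _ sS'.
  pose d := Num.min (e / 2) s.
  have d0 : 0 < d by rewrite lt_min s0 divr_gt0.
  have de : d <= e / 2 by rewrite ge_min lexx.
  have ds : d <= s by rewrite ge_min lexx orbT.
  have : ball s e (s - d) by rewrite /ball/= opprB addrC subrK gtr0_norm//; lra.
  move=> /He /= Hd.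
  have sd0 : 0 <= s - d < s by apply/andP; split; lra.
  have sdS : s - d \in `[0, S].
    by rewrite in_itv/=; apply/andP; split; lra.
  have := curve_near_le sdS (sr _ sd0).
  have := lerB_dist (c s - x) (c (s - d) - x).
  have := ww; lra.
Qed.

Lemma curve_in_ball (s : R) : s \in `[0, S] -> ball x0 r (c s).
Proof.
move=> /curve_short; move: x0x; rewrite -!ball_normE /=.
have -> : x0 - c s = (x0 - x) - (c s - x) by rewrite opprB addrA subrK.
have := ler_normB (x0 - x) (c s - x); have := ww; lra.
Qed.

(** Differentiating H_x(c s - x) = s tau_0 shows that a map within one half of the identity sends c'
    to tau_0, so |c'| <= 2 |k0(tau_0)|; [curve_speed_le] concludes. *)
Lemma curve_speed (s : R) : s \in `]0, S[ ->
  `|S *: derive1 c s| <= 3 * `|x' - x|.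
Proof.
move=> sS; have sS' := subset_itv_oo_cc sS.
have cr : `|c s - x| < r.
  by have := curve_short sS'; have := normr_ge0 (x' - x); have := ww; lra.
have dz : is_derive s 1 (fun t => c t - x) (derive1 c s).
  rewrite -[derive1 c s]subr0.
  exact: is_deriveB (canonical_curve_derive sS') (is_derive_cst x s 1).
have [Ds _] := curve_ray sS'; have [dU _ _] := dmap_C2 0 0 Ds.
have d1 := is_derive_linear_comp k0_cont dz dU.
have E : \forall t \near s, k0 (D x (c t - x)) = t *: k0 (tau 0).
  apply: filterS (near_itv_oo sS) => t tS.
  by have [_ ->] := curve_ray tS; rewrite linearZ.
have vE := is_derive_unique E d1 (is_derive_scalel _ _).
have := chart_id B x0rx cr (derive1 c s).
rewrite [X in X - _](_ : _ = k0 (tau 0)); last exact: vE.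
move=> H.
have : `|derive1 c s| <= 2 * `|k0 (tau 0)|.
  have := lerB_dist (derive1 c s) (k0 (tau 0)); rewrite distrC; lra.
have := curve_speed_le; rewrite !normrZ (ger0_norm S0) => H1 H2.
have : S * `|derive1 c s| <= S * (2 * `|k0 (tau 0)|) by rewrite ler_wpM2l.
lra.
Qed.

(** Rescaling to [0, 1] removes the length S, which differs between deformations; H_x(x' - x) = S
    tau_0 then depends only on [x] and the initial velocity S c'(0). *)
Lemma canonical_geodesic : exists C C1 C2,
  [/\ is_geodesic (chart_a k0 D) (chart_b k0 D) (ball x0 r)
         (3 * `|x' - x|) C C1 C2,
      C 0 = x, C 1 = x', ddom D (x, x' - x) &
      k0 (D x (x' - x)) = lin_at (chart_a k0 D) x (C1 0)].
Proof.
have zS : S \in `[0, S] by rewrite in_itv/= lexx S0.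
have [DS] := curve_ray zS; rewrite cS => ES; rewrite cS in DS.
exists (fun s => c (S * s)), (fun s => S *: derive1 c (S * s)),
  (fun s => S *: (S *: derive1 (derive1 c) (S * s))).
have Ss (s : R) : s \in `[0, 1] -> S * s \in `[0, S].
  rewrite !in_itv/= => /andP[s0 s1].
  by rewrite mulr_ge0 ?S0//= ler_piMr// S0.
have EC : k0 (D x (x' - x)) = lin_at (chart_a k0 D) x (S *: derive1 c (S * 0)).
  rewrite mulr0 (lin_at_chart_a k0 _ Xx) ES coef_hZ.
  by rewrite -[in RHS]c0.
suff geo : is_geodesic (chart_a k0 D) (chart_b k0 D) (ball x0 r) (3 * `|x' - x|)
    (fun s => c (S * s)) (fun s => S *: derive1 c (S * s))
    (fun s => S *: (S *: derive1 (derive1 c) (S * s))).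
  by split; [exact: geo|rewrite mulr0|rewrite mulr1|exact: DS|exact: EC].
split=> s s01.
- exact/is_derive_comp_mull/canonical_curve_derive/Ss.
- apply: is_deriveZ.
  exact/is_derive_comp_mull/canonical_curve_derive2/Ss.
- have s01' := subset_itv_oo_cc s01.
  split; first exact/curve_in_ball/Ss.
    (* For S = 0 the rescaled curve is constant, and ]0, S[ contains no parameter at which
       [curve_speed] could be used. *)
    have [S_0|Sn0] := eqVneq S 0.
      by rewrite S_0 scale0r normr0 mulr_ge0.
    apply: curve_speed; move: s01; rewrite !in_itv/= => /andP[s0 s1].
    have Sp : 0 < S by rewrite lt_neqAle eq_sym Sn0 S0.
    by rewrite mulr_gt0//= gtr_pMr.
  set v := derive1 c _; set a := derive1 _ _; set p := c _.
  have -> : lin_at (chart_a k0 D) p (S *: (S *: a)) =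
      (S * S) *: lin_at (chart_a k0 D) p a.
    rewrite /lin_at scaler_sumr; apply: eq_bigr => j _.
    by rewrite !mxE scalerA mulrA.
  have -> : bilin_at (chart_b k0 D) p (S *: v) (S *: v) =
      (S * S) *: bilin_at (chart_b k0 D) p v v.
    rewrite /bilin_at scaler_sumr; apply: eq_bigr => i _.
    rewrite scaler_sumr; apply: eq_bigr => j _.
    by rewrite !mxE scalerA mulrACA.
  have [->|Sn0] := eqVneq S 0; first by rewrite mul0r !scale0r addr0.
  rewrite -scalerDr geodesic_equation ?scaler0//.
  move: s01; rewrite !in_itv/= => /andP[s0 s1].
  have Sp : 0 < S by rewrite lt_neqAle eq_sym Sn0 S0.
  by rewrite mulr_gt0//= gtr_pMr.
Qed.

End Geodesic.
End Curve.

(** Inverse function theorem with a radius uniform in [x]; [dimg_open] treats each [x] separately. A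
    minimizer of the residual on the closed ball has residual zero. *)
Lemma chart_surj {R : realType} {n : nat} {T : normedModType R}
    (X : set 'rV[R]_n) (D : deformation T X) (k0 : {linear T -> 'rV[R]_n})
    (x0 : 'rV[R]_n) (r L rho : R) :
  continuous k0 -> injective k0 -> chart_bounds k0 D x0 r L -> 0 <= rho < r ->
  forall x t, ball x0 r x -> `|k0 t| <= rho / 2 ->
  exists2 v, `|v| <= rho & D x v = t.
Proof.
move=> k0_cont k0_inj B /andP[rho0 rhor] x t bx kt.
pose A := [set v : 'rV[R]_n | `|v| <= rho].
pose g v := v - k0 (D x v) + k0 t.
have Ar v : A v -> `|v| < r by move=> Av; exact: le_lt_trans rhor.
(* The displacement defect is at most rho / 2, and so is [k0 t]; hence the bound rho / 2 on the
   target. *)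
have gA : {homo g : v / A v >-> A v}.
  move=> v Av; rewrite /A /g /=; apply: (le_trans (ler_normD _ _)).
  have := chart_norm_le k0_cont B bx (Ar _ Av); rewrite distrC.
  by move: Av; rewrite /A/=; lra.
have A0 : A !=set0 by exists 0; rewrite /A/= normr0.
have Acompact : compact A.
  apply: bounded_closed_compact.
    exists rho; split; first exact: num_real.
    by move=> M rhoM v /le_trans; apply; exact: ltW.
  apply: (@closed_comp _ _ (fun v : 'rV[R]_n => `|v|) [set y | y <= rho]).
    by move=> v _; exact: norm_continuous.
  exact: closed_le.
pose f v := `|k0 (D x v) - k0 t|.
have fc : {within A, continuous f}.
  apply: continuous_in_subspaceT => v /set_mem Av.
  have Dv := chart_ddom B bx (Ar _ Av).
  apply: (@continuous_comp _ _ _ (fun v => k0 (D x v) - k0 t) Num.norm).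
    apply: continuousB; last exact: cst_continuous.
    apply: (@continuous_comp _ _ _ (D x) k0); last exact: k0_cont.
    exact/differentiable_continuous/differentiable_dmap.
  exact: norm_continuous.
(* A simplified Newton step halves the minimal residual. *)
have [v /set_mem Av vmin] := EVT_min_rV A0 Acompact fc.
exists v => //; apply: k0_inj; apply/eqP; rewrite -subr_eq0 -normr_le0.
have := vmin (g v) (mem_set (gA _ Av)).
have := chart_near_id k0_cont B bx (Ar _ (gA _ Av)) (Ar _ Av).
rewrite /f; set a := k0 (D x (g v)); set b := k0 (D x v).
have -> : g v - v = - (b - k0 t).
  by rewrite /g -/b; apply/matrixP => i j; rewrite !mxE; ring.
rewrite opprK normrN.
have -> : a - b + (b - k0 t) = a - k0 t by rewrite addrA subrK.
lra.
Qed.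

(** * Comparison of two deformations *)

Section TwoDeformations.
Context {R : realType} {n : nat} {T : normedModType R}.
Local Notation V := ('rV[R]_n).
Variables (X : set V) (H H' : deformation T X).

Definition agree (p : V * V) : Prop :=
  [/\ ddom H p, ddom H' p & H p.1 p.2 = H' p.1 p.2].

Hypotheses (eq_h : forall x, X x -> forall v, coef_h H x v = coef_h H' x v)
  (eq_Gamma : forall x, X x -> forall u v,
     connection H x u v = connection H' x u v).

Lemma eq_D2 x u v : X x -> D2 (H x) 0 u v = D2 (H' x) 0 u v.
Proof.
move=> Xx; rewrite -[LHS](coef_kK H _ Xx).
by rewrite -/(connection H x u v) eq_Gamma// eq_h// coef_kK.
Qed.

Lemma eq_chart_a (k0 : {linear T -> V}) j x : X x ->
  chart_a k0 H j x = chart_a k0 H' j x.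
Proof.
move=> Xx; rewrite /chart_a /chart_d1 -(coef_hE H _ Xx) -(coef_hE H' _ Xx).
by rewrite eq_h.
Qed.

Lemma eq_chart_b (k0 : {linear T -> V}) i j x : X x ->
  chart_b k0 H i j x = chart_b k0 H' i j x.
Proof. by move=> Xx; rewrite /chart_b -!D2_dmapE eq_D2. Qed.

Hypotheses (canH : canonical H) (canH' : canonical H').

Lemma canonical_agree x0 : X x0 -> \forall p \near (x0, x0),
  agree (p.1, p.2 - p.1).
Proof.
move=> Xx0.
have [k0 [k0_cont k0h k0_inj]] := coef_k_chart H Xx0.
have k0h' v : k0 (coef_h H' x0 v) = v by rewrite -eq_h.
have [r1 [L1 B1]] := chart_boundsP k0_cont Xx0 k0h.
have [r2 [L2 B2]] := chart_boundsP k0_cont Xx0 k0h'.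
have r10 := chart_r0 B1; have r20 := chart_r0 B2.
pose r := Num.min r1 r2; pose L := Num.max L1 L2.
have r0 : 0 < r by rewrite lt_min r10.
have rr1 : r <= r1 by rewrite ge_min lexx.
have rr2 : r <= r2 by rewrite ge_min lexx orbT.
have LL1 : L1 <= L by rewrite le_max lexx.
have LL2 : L2 <= L by rewrite le_max lexx orbT.
have B := chart_boundsW r0 rr1 LL1 B1.
have B' := chart_boundsW r0 rr2 LL2 B2.
have L_1 := chart_L1 B.
have L0 : 0 < L by apply: lt_le_trans L_1.
have r00 : `|0 : V| < r by rewrite normr0.
have bX z : ball x0 r z -> X z.
  by move=> bz; exact: ddom_sub (chart_ddom B bz r00).
have aid z : ball x0 r z -> forall u : V,
    `|lin_at (chart_a k0 H) z u - u| <= 2^-1 * `|u|.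
  by move=> bz u; exact: (chart_id B bz r00).
have lin_eq z u : X z -> lin_at (chart_a k0 H') z u = lin_at (chart_a k0 H) z u.
  by move=> Xz; apply: eq_bigr => j _; rewrite eq_chart_a.
have bilin_eq z u v : X z ->
    bilin_at (chart_b k0 H') z u v = bilin_at (chart_b k0 H) z u v.
  by move=> Xz; do 2!apply: eq_bigr => ? _; rewrite eq_chart_b.
(* r / 6 keeps the curves in the chart; 1 / 3 and 60 L^2 are the conditions D <= 1 and 20 L^2 D <= 1
   for the speed bound D = 3 |x' - x|. *)
pose d := Num.min (r / 6) (Num.min (1 / 3) (60 * L ^+ 2)^-1).
have d0 : 0 < d.
  rewrite !lt_min invr_gt0 !mulr_gt0// ?exprn_gt0// ?invr_gt0//.
have nd : \forall p \near (x0, x0), `|p.2 - p.1| < d.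
  have : {for (x0, x0), continuous (fun p : V * V => p.2 - p.1)}.
    by apply: continuousB; [exact: cvg_snd|exact: cvg_fst].
  move=> /cvgrPdist_lt/(_ _ d0); apply: filterS => p.
  by rewrite /= subrr sub0r normrN.
have nb : \forall p \near (x0, x0), ball x0 (r / 2) p.1.
  have : {for (x0, x0), continuous (fun p : V * V => p.1)} by exact: cvg_fst.
  by apply; apply: nbhsx_ballx; rewrite divr_gt0.
have nbd : \forall p \near (x0, x0), `|p.2 - p.1| < d /\ ball x0 (r / 2) p.1.
  exact: filterI.
apply: filterS3 nbd (canH Xx0) (canH' Xx0) => -[x x'] /= [wd bx].
move=> [S [I [c cc]]] [S' [I' [c' cc']]].
move: wd; rewrite !lt_min => /and3P[w1 w2 w3].
have w0 := normr_ge0 (x' - x).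
have ww : 6 * `|x' - x| < r by rewrite mulrC -ltr_pdivlMr.
have [C [C1 [C2 [geo C_0 C_1 Dw Ew]]]] := canonical_geodesic cc k0_cont B bx ww.
have [E [E1 [E2 [[dE dE1 geoE] E_0 E_1 Dw' Ew']]]] :=
  canonical_geodesic cc' k0_cont B' bx ww.
(* Both equations have the same coefficients because the same [k0] reads [H] and [H']. *)
have geo' : is_geodesic (chart_a k0 H) (chart_b k0 H) (ball x0 r)
    (3 * `|x' - x|) E E1 E2.
  split; [exact dE|exact dE1|move=> s s01].
  have [bE E1w gE] := geoE _ s01; split; [exact bE|exact E1w|].
  by rewrite -(lin_eq _ _ (bX _ bE)) -(bilin_eq _ _ _ (bX _ bE)).
have D01 : 0 <= 3 * `|x' - x| <= 1.
  by apply/andP; split; [rewrite mulr_ge0|lra].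
have D20 : 20 * L ^+ 2 * (3 * `|x' - x|) <= 1.
  have : `|x' - x| * (60 * L ^+ 2) <= 1.
    by rewrite -ler_pdivlMr ?div1r ?ltW// mulr_gt0// exprn_gt0.
  set L22 := L ^+ 2; lra.
have CE0 : C 0 = E 0 by rewrite C_0 E_0.
have CE1 : C 1 = E 1 by rewrite C_1 E_1.
have EC := geodesic_unique L_1 aid (chart_a_lip B) (chart_b_bound B)
  (chart_b_lip B) D01 D20 geo geo' CE0 CE1.
have bxr : ball x0 r x by apply: le_ball bx; lra.
split; [exact Dw|exact Dw'|apply: k0_inj].
by rewrite Ew Ew' EC (lin_eq _ _ (bX _ bxr)).
Qed.

Lemma near_agree x0 : X x0 -> \forall p \near (x0, 0 : V), agree p.
Proof.
move=> /canonical_agree/nbhs_ballP[e /= e0 He].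
apply/nbhs_ballP; exists (e / 2); first by rewrite /= divr_gt0.
move=> [x v] [/= bx bv].
have <- : (x + v) - x = v by rewrite addrC addKr.
apply: (He (x, x + v)); split => /=; first by apply: le_ball bx; lra.
move: bx bv; rewrite -!ball_normE /= sub0r normrN => bx bv.
have := ler_normB (x0 - x) v; rewrite opprD addrA; lra.
Qed.

(* The quotient [r / 4] makes products of two small elements land where [H] and
   [H'] agree: if [r] and [r'] are the radii at [x] and [x + v], then [v + v']
   is covered by the ball at [x] when [r' <= 3 * r], by that at [x + v]
   otherwise. *)
Definition gauge_tube : set (V * T) := [set p | exists v r,
  [/\ H p.1 v = p.2, `|v| < r / 4 &
      forall z u, ball p.1 r z -> `|u| < r -> agree (z, u)]].

Lemma gauge_tube0 x0 : X x0 -> \forall p \near (x0, 0 : T), gauge_tube p.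
Proof.
move=> Xx0.
have [k0 [k0_cont k0h k0_inj]] := coef_k_chart H Xx0.
have [r1 [L B]] := chart_boundsP k0_cont Xx0 k0h.
have r10 := chart_r0 B.
have /nbhs_ballP[r2 /= r20 Hr2] := near_agree Xx0.
have {}Hr2 z u : ball x0 r2 z -> `|u| < r2 -> agree (z, u).
  move=> bz ur; apply: Hr2; split => //=.
  by rewrite -ball_normE /= sub0r normrN.
(* r1 / 2 is below the chart radius, as [chart_surj] requires; r2 / 16 is below a quarter of r2 / 2,
   the radius used as witness of the tube. *)
pose rho := Num.min (r1 / 2) (r2 / 16).
have rho0 : 0 < rho by rewrite lt_min !divr_gt0.
have rho1 : rho <= r1 / 2 by rewrite ge_min lexx.
have rho2 : rho <= r2 / 16 by rewrite ge_min lexx orbT.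
have n1 : \forall p \near (x0, 0 : T), ball x0 r1 p.1.
  have : {for (x0, 0 : T), continuous (fun p : V * T => p.1)} by exact: cvg_fst.
  by apply; exact: nbhsx_ballx.
have n2 : \forall p \near (x0, 0 : T), ball x0 (r2 / 2) p.1.
  have : {for (x0, 0 : T), continuous (fun p : V * T => p.1)} by exact: cvg_fst.
  by apply; apply: nbhsx_ballx; rewrite divr_gt0.
have n3 : \forall p \near (x0, 0 : T), `|k0 p.2| <= rho / 2.
  have cp : {for (x0, 0 : T), continuous (fun p : V * T => k0 p.2)}.
    apply: (@continuous_comp _ _ _ (fun p : V * T => p.2) k0).
      exact: cvg_snd.
    exact: k0_cont.
  have rho20 : 0 < rho / 2 by rewrite divr_gt0.
  move/cvgrPdist_le: cp => /(_ _ rho20); apply: filterS => p.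
  by rewrite /= linear0 sub0r normrN.
apply: filterS3 n1 n2 n3 => -[x t] /= bx1 bx2 kt.
have rr : 0 <= rho < r1 by apply/andP; split; lra.
have [v vrho vt] := chart_surj k0_cont k0_inj B rr bx1 kt.
exists v, (r2 / 2); split => //=; first lra.
move=> z u bz ur; apply: Hr2; last lra.
have := ball_triangle bx2 bz; apply: le_ball; lra.
Qed.

Lemma gauge_tube_dinv x t : gauge_tube (x, t) ->
  [/\ dimg H x t, dimg H' x t & dinv H x t = dinv H' x t].
Proof.
move=> [v [r [/= vt vr ag]]].
have r0 : 0 < r by have := normr_ge0 v; lra.
have [Dv D'v Ev] : agree (x, v).
  by apply: ag; [exact: ballxx|have := normr_ge0 v; lra].
rewrite /= in Ev; split.
- by apply/dimgP; exists v.
- by apply/dimgP; exists v => //; rewrite -Ev.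
- by rewrite -vt (dmapK Dv) Ev (dmapK D'v).
Qed.

Lemma gauge_tube_act x t : gauge_tube (x, t) -> X (x + dinv H x t).
Proof.
move=> [v [r [/= vt vr ag]]].
have v0 := normr_ge0 v.
have r0 : 0 < r by lra.
have [Dv _ _] : agree (x, v) by apply: ag; [exact: ballxx|lra].
rewrite -vt (dmapK Dv).
have [D0 _ _] : agree (x + v, 0).
  apply: ag; last by rewrite normr0.
  by rewrite -ball_normE /= opprD addNKr normrN; lra.
exact: ddom_sub D0.
Qed.

Lemma gauge_tube_mul x t t' :
  gauge_tube (x, t) -> gauge_tube (x + dinv H x t, t') ->
  agree (x, dinv H x t + dinv H (x + dinv H x t) t').
Proof.
move=> [v [r [/= vt vr ag]]].
have v0 := normr_ge0 v.
have r0 : 0 < r by lra.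
have [Dv _ _] : agree (x, v) by apply: ag; [exact: ballxx|lra].
rewrite -vt (dmapK Dv) => -[v' [r' [/= v't vr' ag']]].
have v'0 := normr_ge0 v'.
have r'0 : 0 < r' by lra.
have [D'v' _ _] : agree (x + v, v') by apply: ag'; [exact: ballxx|lra].
rewrite -v't (dmapK D'v').
have vv := ler_normD v v'.
have [r'r|rr'] := leP r' (3 * r); first by apply: ag; [exact: ballxx|lra].
apply: ag'; last lra.
by rewrite -ball_normE /= addrC addKr; lra.
Qed.

(** As [X] is open, the two actions agree around each point, so they have the same derivative
    there. *)
Lemma gauge_elt_tube (X_open : open X) (t : V -> T) :
  (forall x, X x -> gauge_tube (x, t x)) -> gauge_elt H t -> gauge_elt H' t.
Proof.
move=> small [st elt]; split; [exact st|move=> x Xx].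
have [_ dt bt] := elt x Xx.
have actE : {near x, gauge_act H t =1 gauge_act H' t}.
  have : \forall z \near x, X z by exact: open_nbhs_nbhs.
  apply: filterS => z Xz; rewrite /gauge_act.
  by have [_ _ ->] := gauge_tube_dinv (small z Xz).
split; first by have [] := gauge_tube_dinv (small x Xx).
  exact: near_eq_differentiable actE dt.
exact: eq_bij bt _ (near_eq_diff actE dt).
Qed.

End TwoDeformations.

Theorem proposition2 (R : realType) (n : nat) (T : normedModType R)
    (T_iso : exists L : {linear 'rV[R]_n -> T}, bijective L)
    (X : set 'rV[R]_n) (X_open : open X)
    (H H' : deformation T X)
    (H_canonical : canonical H) (H'_canonical : canonical H')
    (eq_h : forall x, X x -> forall v, coef_h H x v = coef_h H' x v)
    (eq_Gamma : forall x, X x -> forall u v,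
       connection H x u v = connection H' x u v) :
  (forall x, X x -> \forall p \near (x, 0 : 'rV[R]_n),
     H p.1 p.2 = H' p.1 p.2) /\
  gauge_groups_coincide H H'.
Proof.
have agr x (Xx : X x) := near_agree eq_h eq_Gamma H_canonical H'_canonical Xx.
split=> [x Xx|]; first by apply: filterS (agr x Xx) => p [].
have eq_h' x : X x -> forall v, coef_h H' x v = coef_h H x v.
  by move=> Xx v; rewrite eq_h.
have eq_Gamma' x : X x -> forall u v, connection H' x u v = connection H x u v.
  by move=> Xx u v; rewrite eq_Gamma.
(* The tube is written in terms of its first deformation, and the equivalence of gauge elements uses
   it in both orders. Both tubes are neighbourhoods of the zero section, which therefore lies in the
   interior. *)
pose W := (gauge_tube H H' `&` gauge_tube H' H)°%classic.
have W1 p : W p -> gauge_tube H H' p by move=> /interior_subset[].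
have W2 p : W p -> gauge_tube H' H p by move=> /interior_subset[].
exists W; split; first exact: open_interior.
  move=> x Xx; apply: filterI; first exact: gauge_tube0.
  exact: gauge_tube0.
move=> small; split=> [t st|t st _ x /set_mem Xx|t t' st st' _ _].
- split; first by apply: gauge_elt_tube => // x /st/W1.
  by apply: gauge_elt_tube => // x /st/W2.
- by rewrite /gauge_act; have [_ _ ->] := gauge_tube_dinv (W1 _ (st x Xx)).
have key x : X x -> [/\ phi_defined H x (t x) (t' (gauge_act H t x)),
    phi_defined H' x (t x) (t' (gauge_act H' t x)) &
    gauge_mul H t t' x = gauge_mul H' t t' x].
  move=> Xx; have tx := W1 _ (st x Xx).
  have [Dt D't Et] := gauge_tube_dinv tx.
  pose y := x + dinv H x (t x).
  (* The second factor is evaluated at the moved point, so smallness of [t'] applies only once that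
     point is known to lie in [X]. *)
  have Xy : X y by exact: gauge_tube_act tx.
  have ty := W1 _ (st' y Xy).
  have [Dt' D't' Et'] := gauge_tube_dinv ty.
  have [Dm D'm Em] := gauge_tube_mul tx ty.
  rewrite /gauge_mul /gauge_act /phi -Et -/y -Et'; split.
  + exact: And3.
  + by rewrite /phi_defined -Et -Et'; exact: And3.
  + exact: Em.
split=> x.
- by move=> /key[].
- by move=> /key[].
- by move=> /set_mem/key[].
Qed.
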